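(* Let $n\ge 1$ and let $A\subseteq\mathbb{R}^n$ be a finite set of cardinality $t\ge 1$ whose convex hull $P$ has $V_0$ vertices. Then $$\mathbb{E}(A,\ldots,A)\ \le\ \frac{1}{\mathrm{vol}(\mathbb{P}^n)}\,V_0\,\binom{t-1}{n},$$ where $A$ is repeated $n$ times on the left-hand side.
   Context: For a finite nonempty set $A\subseteq\mathbb{R}^n$ and a function $c\colon A\to\mathbb{R}$, define $F_{A,c}\colon\mathbb{R}^n\to\mathbb{R}$ by $F_{A,c}(w)=\sum_{a\in A}c(a)e^{\langle a,w\rangle}$. For finite nonempty $A_1,\ldots,A_n\subseteq\mathbb{R}^n$, let all the coefficients $c_i(a)$, $i\in\{1,\ldots,n\}$, $a\in A_i$, be independent standard Gaussian random variables (also when some of the $A_i$ coincide). Then $\mathbb{E}(A_1,\ldots,A_n)$ denotes the expectation of the number of nondegenerate zeros $w\in\mathbb{R}^n$ of the system $F_{A_1,c_1}(w)=0,\ldots,F_{A_n,c_n}(w)=0$, where a zero is nondegenerate if the Jacobian determinant of $(F_{A_1,c_1},\ldots,F_{A_n,c_n})$ does not vanish there. $\mathrm{vol}(\mathbb{P}^n)=\pi^{\frac{n+1}{2}}/\Gamma(\frac{n+1}{2})$ is the volume of real projective space $\mathbb{P}^n$ with its standard Riemannian metric. The binomial coefficient $\binom{t-1}{n}$ is $0$ if $t-1<n$. *)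

(* Defs.v *)
From HB Require Import structures.
From mathcomp Require Import all_boot all_order all_algebra finmap.
From mathcomp Require Import all_classical all_reals all_analysis.

Set Implicit Arguments.
Unset Strict Implicit.
Unset Printing Implicit Defensive.

Import Order.TTheory GRing.Theory Num.Theory.
Import numFieldNormedType.Exports.

Local Open Scope classical_set_scope.
Local Open Scope ring_scope.

Definition dotp (R : realType) (n : nat) (u v : 'rV[R]_n) : R :=
  \sum_(j < n) u 0 j * v 0 j.

Definition convex_hull (R : realType) (n : nat) (X : set 'rV[R]_n) :
    set 'rV[R]_n :=
  smallest (fun C => convex_set (C : set (convex_lmodType 'rV[R]_n))) X.

(* The zero-dimensional faces: v is a vertex when some linear functional
   attains its maximum over Q at v and only there; the zero functional accounts
   for the case where Q is a point. *)
Definition vertices (R : realType) (n : nat) (Q : set 'rV[R]_n) :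
    set 'rV[R]_n :=
  [set v | Q v /\
    exists u : 'rV[R]_n, forall x, Q x -> x != v -> dotp u x < dotp u v].

Definition Gamma (R : realType) (s : R) : R :=
  \int[@lebesgue_measure R]_(x in `]0, +oo[) (x `^ (s - 1) * expR (- x)).

Definition vol_proj (R : realType) (n : nat) : R :=
  pi `^ (n.+1%:R / 2) / Gamma (n.+1%:R / 2).

Definition exp_sum (R : realType) (n : nat) (A : {fset 'rV[R]_n})
    (c : A -> R) (w : 'rV[R]_n) : R :=
  \sum_(a : A) c a * expR (dotp (val a) w).

Definition exp_system (R : realType) (n : nat) (A : 'I_n -> {fset 'rV[R]_n})
    (c : forall i, A i -> R) (w : 'rV[R]_n) : 'rV[R]_n :=
  \row_(i < n) exp_sum (c i) w.

Definition nondegenerate_zeros (R : realType) (n : nat)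
    (f : 'rV[R]_n -> 'rV[R]_n) : set 'rV[R]_n :=
  [set w | f w = 0 /\ \det ('J f w) != 0].

Definition mutually_independent (R : realType) (d : measure_display)
    (T : measurableType d) (P : probability T R) (I : finType)
    (X : I -> {RV P >-> R}) : Prop :=
  forall (J : {set I}) (B : I -> set R),
    (forall i, i \in J -> measurable (B i)) ->
    P (\bigcap_(i in [set` J]) (X i @^-1` B i)) =
      (\prod_(i in J) P (X i @^-1` B i))%E.

(* Values of measures outside the sigma-algebra carry no information, hence
   the restriction to measurable sets. *)
Definition standard_gaussian (R : realType) (d : measure_display)
    (T : measurableType d) (P : probability T R) (X : {RV P >-> R}) : Prop :=
  forall B : set R, measurable B -> distribution P X B = normal_prob 0 1 B.

(* The family is indexed by the pairs (i, a) with a in A i, so coefficients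
   attached to different i are independent even if some of the A i coincide. *)
Definition iid_standard_gaussian (R : realType) (d : measure_display)
    (T : measurableType d) (P : probability T R) (n : nat)
    (A : 'I_n -> {fset 'rV[R]_n}) (c : forall i, A i -> {RV P >-> R}) : Prop :=
  (forall i (a : A i), standard_gaussian (c i a)) /\
  mutually_independent
    (fun ia : {i : 'I_n & A i} => c (tag ia) (tagged ia)).

(* [counting] is +oo on infinite sets. *)
Definition expected_nondegenerate_zeros (R : realType) (d : measure_display)
    (T : measurableType d) (P : probability T R) (n : nat)
    (A : 'I_n -> {fset 'rV[R]_n}) (c : forall i, A i -> {RV P >-> R}) : \bar R :=
  (\int[P]_x
     counting (nondegenerate_zeros (exp_system (fun i a => c i a x))))%E.

(* Main.v *)
Require Import Defs.
From HB Require Import structures.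
From mathcomp Require Import all_boot all_order all_algebra finmap.
From mathcomp Require Import fingroup perm.
From mathcomp Require Import all_classical all_reals all_analysis.
From mathcomp Require Import measurable_realfun ring lra.

Set Implicit Arguments.
Unset Strict Implicit.
Unset Printing Implicit Defensive.

Import Order.TTheory GRing.Theory Num.Theory.
Import numFieldNormedType.Exports.

Local Open Scope classical_set_scope.
Local Open Scope ring_scope.

(** Why the bound holds. Every zero [z] of the system is assigned to a vertex
    [v] of the hull that maximizes the inner product with [z] over [A]. Divided by
    exp <v, w>, the equations become sums of c_i(a) exp <a - v, w> with
    <a - v, z> <= 0 for all [a], in which c(v) is the constant term. Let F be
    this system and D its Jacobian matrix, and fix eta > 0. If [z] is
    nondegenerate and eps is small, then every [w] in the cube of radius eps
    around [z] satisfies the Newton event of [v]: <a - v, w> < eta for all [a],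
    and the entries of the Newton correction D(w)^-1 F(w) are at most
    (1 + eta) eps in absolute value ([newton_step_small], [zero_detected]). The
    cubes around finitely many zeros are disjoint for small eps, so the number
    of zeros is at most the lower limit, as eps tends to 0, of the volume of
    the Newton events of all vertices divided by the volume (2 eps)^n of a cube
    ([newton_volume_ge], [counting_le_newton_volume]). By Fatou and Tonelli it
    remains to integrate the probabilities of the Newton events over [w].

    For fixed [v] and [w], the matrix D(w) does not depend on the Gaussian vector
    c(v), since the frequency a - v vanishes for a = v, and F(w) is c(v) plus a
    constant. The density of c(v) is at most p^n, where p = (2 pi)^(-1/2) is the
    peak of the Gaussian density. Hence the conditional probability of the
    Newton event is at most p^n (2 (1 + eta) eps)^n |det D(w)| on the cone
    where all <a - v, w> < eta ([integral_newton_indicator]).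

    D(w) is the product of the Gaussian coefficient matrix and the matrix with
    rows (a - v) exp <a - v, w>. By the Cauchy-Binet formula, E |det D(w)| is at
    most E |det G| times the sum, over the n-subsets S of A minus v, of the
    absolute minors of the second factor, where G is an n x n Gaussian matrix.
    The integral of each minor over the cone is at most exp (n eta), by the
    substitution s_a = <a - v, w> for a in S ([integral_in_cone_rowsel]). There
    are binomial(t - 1, n) subsets S.

    Finally p^n E |det G| <= 1 / vol(P^n) ([absdet_int_le]): the solution u of
    a linear system G u = g with an independent Gaussian right-hand side has
    the density p^n E |det G| (1 + |u|^2)^(-(n+1)/2), and the last factor
    integrates to vol(P^n) ([cauchy_intE]). Every vertex thus contributes at
    most ((1 + eta) exp eta)^n binomial(t - 1, n) / vol(P^n), and eta tends
    to 0. *)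

(** * Affine substitutions and the Gaussian density on the line *)

Section one_dim.
Context {R : realType}.
Local Notation leb := (@lebesgue_measure R).

Lemma affine_preimage_itv (a b x y : R) : a != 0 ->
  leb ((fun s : R => a * s + b) @^-1` `]x, y]) = (`|a|^-1%:E * leb `]x, y])%E.
Proof.
move=> a0.
have [ap|an] : 0 < a \/ a < 0 by move: a0; rewrite neq_lt => /orP[]; [right|left].
- have -> : (fun s : R => a * s + b) @^-1` `]x, y] = `](x - b) / a, (y - b) / a]%classic.
    apply/seteqP; split => s /=; rewrite !in_itv/= ltr_pdivrMr// ler_pdivlMr//;
    rewrite (mulrC s); lra.
  rewrite !lebesgue_measure_itv/= !lte_fin ltr_pM2r ?invr_gt0// ltrD2r.
  case: ifPn => _; last by rewrite mule0.
  by rewrite gtr0_norm// -!EFinB -EFinM; congr (_%:E); field.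
- have -> : (fun s : R => a * s + b) @^-1` `]x, y] = `[(y - b) / a, (x - b) / a[%classic.
    apply/seteqP; split => s /=; rewrite !in_itv/= ler_ndivrMr// ltr_ndivlMr//;
    rewrite (mulrC s); lra.
  rewrite !lebesgue_measure_itv/= !lte_fin ltr_nM2r ?invr_lt0// ltrD2r.
  case: ifPn => _; last by rewrite mule0.
  by rewrite ltr0_norm// -!EFinB -EFinM; congr (_%:E); field.
Qed.

(** By uniqueness of Lebesgue measure: its image under the affine map, scaled
    by |a|, has the right value on half-open intervals. *)
Lemma integral_affine (f : R -> \bar R) (a b : R) : a != 0 ->
  measurable_fun [set: R] f -> (forall x, 0 <= f x)%E ->
  (`|a|%:E * \int[leb]_x f (a * x + b)%R = \int[leb]_x f x)%E.
Proof.
move=> a0 mf f0.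
pose aff : measurableTypeR R -> measurableTypeR R := fun x => a * x + b.
have maff : measurable_fun setT aff.
  by apply: measurable_funD => //; exact: measurable_funM.
have a0' : 0 <= `|a| by [].
pose m := mscale (NngNum a0') (measure_function_pushforward__canonical__measure_function_Measure leb maff).
transitivity (\int[m]_x f x)%E; last first.
  apply: eq_measure_integral => /= A mA _.
  apply/esym/lebesgue_measure_unique => //= _ [[x y]] _ <-.
  rewrite /m /mscale/= /pushforward affine_preimage_itv//.
  by rewrite muleA -EFinM divff ?mul1e// normr_eq0.
rewrite ge0_integral_mscale//= ge0_integral_pushforward//.
Qed.

(** The measure has a Radon-Nikodym derivative, and this derivative agrees
    almost everywhere with the explicit density since both have the same
    integral over every measurable set. *)
Lemma integral_normal_prob (f : R -> \bar R) :
  measurable_fun [set: R] f -> (forall x, 0 <= f x)%E ->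
  (\int[normal_prob 0 1]_x f x = \int[leb]_x (f x * (normal_pdf 0 1 x)%:E))%E.
Proof.
move=> mf f0.
have dom := @normal_prob_dominates R 0 1.
rewrite -(Radon_Nikodym_SigmaFinite.change_of_variables dom)//.
apply: ae_eq_integral => //.
- apply: emeasurable_funM => //.
  exact: measurable_int (Radon_Nikodym_SigmaFinite.f_integrable dom).
- apply: emeasurable_funM => //; apply/measurable_EFinP.
  exact: measurable_normal_pdf.
suff : ae_eq leb setT (Radon_Nikodym_SigmaFinite.f (normal_prob 0 1) leb)
    (fun x => (normal_pdf 0 1 x)%:E).
  by apply: filterS => x /= h Dx; rewrite h.
apply: integral_ae_eq => //.
- exact: Radon_Nikodym_SigmaFinite.f_integrable.
- apply/measurable_EFinP; exact: measurable_normal_pdf.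
- by move=> E _ mE; rewrite -Radon_Nikodym_SigmaFinite.f_integral.
Qed.
End one_dim.

(** * Iterated integrals over finitely many coordinates *)

Section coordinates.
Context {R : realType}.
Local Notation leb := (@lebesgue_measure R).
Local Notation smeas := {sigma_finite_measure set (measurableTypeR R) -> \bar R}.

(** Measurability is tested along measurable parametrizations. This takes the
    place of a product sigma-algebra on [S * (I -> R)] and makes stability under
    substitutions immediate. *)
Definition param_measurable d (S : measurableType d) (I : Type) (f : S -> (I -> R) -> \bar R) :=
  forall d' (U : measurableType d') (h : U -> S) (g : U -> I -> R),
    measurable_fun setT h -> (forall i, measurable_fun setT (g^~ i)) ->
    measurable_fun setT (fun u => f (h u) (g u)).

Definition coord_measurable (I : Type) (f : (I -> R) -> \bar R) :=
  forall d (U : measurableType d) (g : U -> I -> R),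
    (forall i, measurable_fun setT (g^~ i)) ->
    measurable_fun setT (fun u => f (g u)).

Lemma coord_measurable_param_measurable d (S : measurableType d) I (f : (I -> R) -> \bar R) :
  coord_measurable f -> param_measurable (fun _ : S => f).
Proof. by move=> mf d' U h g _ mg; exact: mf. Qed.

Variable I : eqType.
Implicit Types (x y : I -> R) (i j : I) (l : seq I).

Definition update x i (s : R) : I -> R := fun j => if j == i then s else x j.

Lemma updateC x i j s t : i != j -> update (update x i s) j t = update (update x j t) i s.
Proof.
move=> ij; apply/funext => k; rewrite /update.
by case: (eqVneq k j) => // ->; rewrite eq_sym (negbTE ij).
Qed.

Definition coord_int (mu : smeas) i (f : (I -> R) -> \bar R) x : \bar R :=
  (\int[mu]_s f (update x i s))%E.

(** The coordinates outside [l] keep the values of the point at which the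
    result is evaluated, so that integrals over several groups of coordinates
    compose. *)
Definition iter_int (mu : smeas) l (f : (I -> R) -> \bar R) : (I -> R) -> \bar R :=
  foldr (coord_int mu) f l.

Lemma iter_int_cat mu l1 l2 f : iter_int mu (l1 ++ l2) f = iter_int mu l1 (iter_int mu l2 f).
Proof. by rewrite /iter_int foldr_cat. Qed.

Lemma coord_int_ge0 mu i f x : (forall x, 0 <= f x)%E -> (0 <= coord_int mu i f x)%E.
Proof. by move=> f0; exact: integral_ge0. Qed.

Lemma iter_int_ge0 mu l f x : (forall x, 0 <= f x)%E -> (0 <= iter_int mu l f x)%E.
Proof.
by move=> f0; elim: l x => [|i l ih] x /=; [exact: f0|exact: coord_int_ge0].
Qed.

Lemma measurable_update d (U : measurableType d) (g : U -> I -> R) i :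
  (forall j, measurable_fun setT (g^~ j)) ->
  forall j, measurable_fun setT (fun u : U * R => update (g u.1) i u.2 j).
Proof.
move=> mg j; rewrite /update; case: eqP => _ /=; first exact: measurable_snd.
by apply: (measurableT_comp (mg j)); exact: measurable_fst.
Qed.

(** A partial integral is measurable by Tonelli. The parameter [s] is what
    allows iterating this, and mixing it with expectations. *)
Lemma param_measurable_coord_int d (S : measurableType d) mu i (f : S -> (I -> R) -> \bar R) :
  param_measurable f -> (forall s x, 0 <= f s x)%E -> param_measurable (fun s => coord_int mu i (f s)).
Proof.
move=> mf f0 d' U h g mh mg.
apply: (@measurable_fun_fubini_tonelli_F _ _ U _ R mu
  (fun u : U * measurableTypeR R => f (h u.1) (update (g u.1) i u.2))) => //.
apply: mf; last exact: measurable_update.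
by apply: measurableT_comp => //; exact: measurable_fst.
Qed.

Lemma param_measurable_iter_int d (S : measurableType d) mu l (f : S -> (I -> R) -> \bar R) :
  param_measurable f -> (forall s x, 0 <= f s x)%E -> param_measurable (fun s => iter_int mu l (f s)).
Proof.
move=> mf f0; elim: l => //= i l ih; apply: param_measurable_coord_int => // s x.
exact: iter_int_ge0.
Qed.

Lemma coord_measurable_iter_int mu l f : coord_measurable f -> (forall x, 0 <= f x)%E ->
  coord_measurable (iter_int mu l f).
Proof.
move=> mf f0 d U g mg.
have := @param_measurable_iter_int _ U mu l (fun=> f) (coord_measurable_param_measurable mf) (fun=> f0) _ U id g.
exact.
Qed.

Lemma coord_measurable_update f x i : coord_measurable f -> measurable_fun [set: R] (fun s => f (update x i s)).
Proof.
move=> mf; apply: mf => j; rewrite /update.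
by case: eqP => _; [exact: measurable_id|exact: measurable_cst].
Qed.

Lemma le_coord_int mu i f g x : coord_measurable f -> coord_measurable g -> (forall x, 0 <= f x)%E ->
  (forall x, f x <= g x)%E -> (coord_int mu i f x <= coord_int mu i g x)%E.
Proof.
move=> mf mg f0 fg; apply: ge0_le_integral => //.
- exact: coord_measurable_update.
- exact: coord_measurable_update.
Qed.

Lemma le_iter_int mu l f g x : coord_measurable f -> coord_measurable g -> (forall x, 0 <= f x)%E ->
  (forall x, f x <= g x)%E -> (iter_int mu l f x <= iter_int mu l g x)%E.
Proof.
move=> mf mg f0 fg; elim: l x => [|i l ih] x //=.
have g0 y : (0 <= g y)%E by exact: le_trans (f0 y) (fg y).
apply: le_coord_int => //; try exact: coord_measurable_iter_int.
by move=> y; exact: iter_int_ge0.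
Qed.

Lemma eq_iter_int mu l f g : f =1 g -> iter_int mu l f = iter_int mu l g.
Proof. by move=> /funext ->. Qed.

Lemma coord_intZl mu i f (k : R) x : 0 <= k -> coord_measurable f -> (forall x, 0 <= f x)%E ->
  (coord_int mu i (fun x => k%:E * f x) x = k%:E * coord_int mu i f x)%E.
Proof.
by move=> k0 mf f0; rewrite /coord_int ge0_integralZl_EFin//; exact: coord_measurable_update.
Qed.

Lemma iter_int_mule mu l f (k : \bar R) x : (0 <= k)%E -> coord_measurable f -> (forall x, 0 <= f x)%E ->
  (iter_int mu l (fun x => k * f x) x = k * iter_int mu l f x)%E.
Proof.
move=> k0 mf f0; elim: l x => [|i l ih] x //=.
rewrite (_ : iter_int mu l _ = fun x => k * iter_int mu l f x)%E; last exact/funext.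
rewrite /coord_int ge0_integralZl//.
- by apply: coord_measurable_update; exact: coord_measurable_iter_int.
- by move=> s _; exact: iter_int_ge0.
Qed.

Lemma iter_int_sum (J : Type) (r : seq J) mu l (f : J -> (I -> R) -> \bar R) x :
  (forall a, coord_measurable (f a)) -> (forall a x, 0 <= f a x)%E ->
  (iter_int mu l (fun x => \sum_(a <- r) f a x) x = \sum_(a <- r) iter_int mu l (f a) x)%E.
Proof.
move=> mf f0; elim: l x => [|i l ih] x //=.
rewrite (_ : iter_int mu l _ = fun x => \sum_(a <- r) iter_int mu l (f a) x)%E;
  last exact/funext.
rewrite /coord_int ge0_integral_sum// => j.
  by apply: coord_measurable_update; exact: coord_measurable_iter_int.
by move=> s _; exact: iter_int_ge0.
Qed.

Lemma coord_intC mu nu i j f x : i != j -> coord_measurable f -> (forall x, 0 <= f x)%E ->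
  coord_int mu i (coord_int nu j f) x = coord_int nu j (coord_int mu i f) x.
Proof.
move=> ij mf f0; rewrite /coord_int.
under [RHS]eq_integral do under eq_integral do rewrite updateC ?(eq_sym j)//.
rewrite (@fubini_tonelli _ _ _ _ R mu nu
  (fun u : measurableTypeR R * measurableTypeR R => f (update (update x i u.1) j u.2)))//.
apply: mf => k; rewrite /update.
case: eqP => _; first exact: measurable_snd.
by case: eqP => _; [exact: measurable_fst|exact: measurable_cst].
Qed.

Lemma integral_coord_intC d (S : measurableType d)
    (nu : {sigma_finite_measure set S -> \bar R}) mu i (f : S -> (I -> R) -> \bar R) x :
  param_measurable f -> (forall s x, 0 <= f s x)%E ->
  (\int[nu]_s coord_int mu i (f s) x = coord_int mu i (fun y => \int[nu]_s f s y) x)%E.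
Proof.
move=> mf f0; rewrite /coord_int.
rewrite (@fubini_tonelli _ _ _ _ R nu mu
  (fun u : S * measurableTypeR R => f u.1 (update x i u.2)))//.
apply: mf; first exact: measurable_fst.
move=> k; rewrite /update.
by case: eqP => _; [exact: measurable_snd|exact: measurable_cst].
Qed.

Lemma coord_measurable_integral d (S : measurableType d)
    (nu : {sigma_finite_measure set S -> \bar R}) (f : S -> (I -> R) -> \bar R) :
  param_measurable f -> (forall s x, 0 <= f s x)%E -> coord_measurable (fun y => \int[nu]_s f s y)%E.
Proof.
move=> mf f0 d' U g mg.
apply: (@measurable_fun_fubini_tonelli_F _ _ U S R nu
  (fun u : U * S => f u.2 (g u.1))) => //.
apply: mf; first exact: measurable_snd.
by move=> i; apply: (measurableT_comp (mg i)); exact: measurable_fst.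
Qed.

Lemma integral_iter_intC d (S : measurableType d)
    (nu : {sigma_finite_measure set S -> \bar R}) mu l (f : S -> (I -> R) -> \bar R) x :
  param_measurable f -> (forall s x, 0 <= f s x)%E ->
  (\int[nu]_s iter_int mu l (f s) x = iter_int mu l (fun y => \int[nu]_s f s y) x)%E.
Proof.
move=> mf f0; elim: l x => [|i l ih] x //=.
rewrite integral_coord_intC//.
- by congr (coord_int _ _ _ _); apply/funext => y; rewrite ih.
- exact: param_measurable_iter_int.
- by move=> s y; exact: iter_int_ge0.
Qed.

(** Tonelli exchanges neighbouring coordinates, which suffices to bring any
    given coordinate to the front. *)
Lemma iter_int_perm mu l1 l2 f : perm_eq l1 l2 -> coord_measurable f -> (forall x, 0 <= f x)%E ->
  iter_int mu l1 f = iter_int mu l2 f.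
Proof.
move=> + mf f0.
have mi l := coord_measurable_iter_int mu l mf f0.
have i0 l x := iter_int_ge0 mu l x f0.
have swap i l : iter_int mu (rcons l i) f = iter_int mu (i :: l) f.
  rewrite -cats1 iter_int_cat /=; elim: l => //= j l ->.
  apply/funext => x; have [->//|ji] := eqVneq j i.
  by rewrite coord_intC.
have mid i l l' : iter_int mu (l ++ i :: l') f = iter_int mu (i :: l ++ l') f.
  elim: l => //= j l ->; apply/funext => x /=; have [->//|ji] := eqVneq j i.
  by rewrite coord_intC.
elim: l1 l2 => [l2 /perm_size|i l1 ih l2 p].
  by case: l2.
have il2 : i \in l2 by rewrite -(perm_mem p) mem_head.
case/splitPr: il2 p => a b p; rewrite mid /= (ih (a ++ b))//.
by rewrite -(perm_cons i) (perm_trans p)// perm_catC /= perm_cons perm_catC.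
Qed.

End coordinates.

Section reindexing.
Context {R : realType}.
Local Notation smeas := {sigma_finite_measure set (measurableTypeR R) -> \bar R}.

(** Tonelli for two families with different index types, such as the entries of
    a matrix and the coordinates of a vector. *)
Lemma iter_int_swap (I J : eqType) (mu nu : smeas) (l : seq I) (m : seq J)
    (f : (I -> R) -> (J -> R) -> \bar R) x y :
  (forall d (U : measurableType d) (h : U -> I -> R) (g : U -> J -> R),
    (forall i, measurable_fun setT (h^~ i)) -> (forall i, measurable_fun setT (g^~ i)) ->
    measurable_fun setT (fun u => f (h u) (g u))) ->
  (forall x y, 0 <= f x y)%E ->
  iter_int mu l (fun x => iter_int nu m (f x) y) x = iter_int nu m (fun y => iter_int mu l (f^~ y) x) y.
Proof.
move=> mf f0; elim: l x => [|i l ih] x //=.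
rewrite (_ : iter_int mu l _ = fun x => iter_int nu m (fun y => iter_int mu l (f^~ y) x) y);
  last exact/funext.
rewrite /coord_int (integral_iter_intC mu nu m (f := fun s y => iter_int mu l (f^~ y) (update x i s)))//.
  move=> d U h g mh mg.
  apply: (param_measurable_iter_int mu l (f := fun u x => f x (g u))) => //.
  - by move=> d' U' h' g' mh' mg'; apply: mf => // j; exact: (measurableT_comp (mg j)).
  - by move=> j; rewrite /update; case: eqP => // _; exact: measurable_cst.
by move=> s y'; apply: iter_int_ge0.
Qed.

Variables (I : eqType) (J : finType) (e : J -> I).
Hypothesis e_inj : injective e.

(** The point [x] with its coordinates along [e] overwritten by [y]: the way to
    treat a block of coordinates as a vector of its own. *)
Definition glue (x : I -> R) (y : J -> R) : I -> R :=
  fun i => if [pick j | e j == i] is Some j then y j else x i.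

Lemma glueE x y j : glue x y (e j) = y j.
Proof.
rewrite /glue; case: pickP => [k /eqP/e_inj ->//|/(_ j)].
by rewrite eqxx.
Qed.

Lemma glueN x y i : (forall j, e j != i) -> glue x y i = x i.
Proof. by move=> h; rewrite /glue; case: pickP => // k; rewrite (negbTE (h k)). Qed.

Lemma glue_id x : glue x (x \o e) = x.
Proof. by apply/funext => i; rewrite /glue; case: pickP => // j /eqP /= ->. Qed.

Lemma glue_glue x y z : glue (glue x y) z = glue x z.
Proof. by apply/funext => i; rewrite /glue; case: pickP. Qed.

Lemma glue_updatel x y j s : glue (update x (e j) s) y = glue x y.
Proof.
apply/funext => i; rewrite /glue; case: pickP => // /(_ j) h.
by rewrite /update eq_sym h.
Qed.

Lemma update_comp x j (s : R) : (update x (e j) s : I -> R) \o e = update (x \o e) j s.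
Proof. by apply/funext => k; rewrite /update /= (inj_eq e_inj). Qed.

Lemma iter_int_map (mu : smeas) l F x :
  iter_int mu (map e l) F x = iter_int mu l (F \o glue x) (x \o e).
Proof.
elim: l x => [|j l ih] x /=; first by rewrite glue_id.
rewrite /coord_int; apply: eq_integral => s _.
rewrite ih update_comp; congr (iter_int _ _ _ _).
by apply/funext => y /=; rewrite glue_updatel.
Qed.

Lemma iter_int_map_comp (mu : smeas) l (f : (J -> R) -> \bar R) x :
  iter_int mu (map e l) (fun x => f (x \o e)) x = iter_int mu l f (x \o e).
Proof.
rewrite iter_int_map; congr (iter_int _ _ _ _); apply/funext => y /=.
by congr f; apply/funext => j /=; rewrite glueE.
Qed.

Lemma coord_measurable_glue f x : coord_measurable f -> coord_measurable (f \o glue x).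
Proof.
move=> mf d U g mg; apply: mf => i; rewrite /glue.
by case: pickP => // *; exact: measurable_cst.
Qed.

End reindexing.

Lemma iter_int_eq {R : realType} (I : eqType) (mu : {sigma_finite_measure set (measurableTypeR R) -> \bar R})
    (l : seq I) f x y : (forall i, i \notin l -> x i = y i) ->
  iter_int mu l f x = iter_int mu l f y.
Proof.
elim: l x y => [|i l ih] x y h /=; first by congr f; apply/funext => i; exact: h.
rewrite /coord_int; apply: eq_integral => s _; apply: ih => j jl.
by rewrite /update; case: eqP => // /eqP ji; apply: h; rewrite inE negb_or ji.
Qed.

(** * Linear change of variables *)

Section linear_change.
Context {R : realType}.
Local Notation leb := (@lebesgue_measure R).
Variable n : nat.
Implicit Types (T M : 'M[R]_n) (x y : 'I_n -> R).

Definition mulv T y : 'I_n -> R := fun i => \sum_k T i k * y k.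

Lemma mulvM T M y : mulv (T *m M) y = mulv T (mulv M y).
Proof.
apply/funext => i; rewrite /mulv.
under eq_bigr do rewrite mxE big_distrl/=.
rewrite exchange_big/=; apply: eq_bigr => k _.
by rewrite big_distrr/=; apply: eq_bigr => j _; rewrite mulrA.
Qed.

Lemma mulv1 y : mulv 1%:M y = y.
Proof.
apply/funext => i; rewrite /mulv (bigD1 i)//= mxE eqxx mul1r big1 ?addr0// => k ki.
by rewrite mxE eq_sym (negbTE ki) mul0r.
Qed.

Lemma measurable_mulv d (U : measurableType d) T (g : U -> 'I_n -> R) :
  (forall i, measurable_fun setT (g^~ i)) ->
  forall i, measurable_fun setT (fun u => mulv T (g u) i).
Proof.
move=> mg i; apply: measurable_sum => k.
by apply: measurable_funM => //; exact: measurable_cst.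
Qed.

Lemma coord_measurable_mulv T (f : ('I_n -> R) -> \bar R) : coord_measurable f -> coord_measurable (f \o mulv T).
Proof. by move=> mf d U g mg; apply: mf; exact: measurable_mulv. Qed.

(** The elementary matrix of a column operation: multiplying by it on the right
    scales column [j] by [m j] and adds [m b] times column [j] to column [b]. *)
Definition rowmx (j : 'I_n) (m : 'I_n -> R) : 'M[R]_n :=
  \matrix_(a, b) if a == j then m b else (a == b)%:R.

Lemma det_rowmx j m : \det (rowmx j m) = m j.
Proof.
rewrite (expand_det_row _ j) (bigD1 j)//= big1 => [|k kj].
  have := expand_det_row (1%:M : 'M[R]_n) j.
  rewrite det1 (bigD1 j)//= big1 => [|k kj]; last first.
    by rewrite mxE eq_sym (negbTE kj) mul0r.
  rewrite !mxE !eqxx mul1r !addr0 => h.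
  rewrite [X in _ * X](_ : _ = 1) ?mulr1// [RHS]h.
  (* cofactors along row j do not involve that row: they are those of 1 *)
  rewrite /cofactor; congr (_ * \det _); apply/matrixP => a b.
  by rewrite !mxE eq_sym (negbTE (neq_lift _ _)).
have := congr1 (fun A : 'M[R]_n => A k j) (mul_mx_adj (1%:M : 'M[R]_n)).
rewrite mul1mx det1 !mxE (negbTE kj) => h.
rewrite [X in _ * X](_ : _ = 0) ?mulr0// -[RHS]h.
rewrite /cofactor; congr (_ * \det _); apply/matrixP => a b.
by rewrite !mxE eq_sym (negbTE (neq_lift _ _)).
Qed.

Lemma mulmx_rowmx T j m i b :
  (T *m rowmx j m) i b = (if b == j then 0 else T i b) + T i j * m b.
Proof.
rewrite mxE (bigD1 j)//= mxE eqxx addrC; congr (_ + _).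
case: eqVneq => [->|bj].
  by apply: big1 => a aj; rewrite mxE (negbTE aj) mulr0.
rewrite (bigD1 b)//= big1 => [|a /andP[aj ab]].
  by rewrite mxE (negbTE bj) eqxx mulr1 addr0.
by rewrite mxE (negbTE aj) (negbTE ab) mulr0.
Qed.

Lemma mulv_rowmx_update j m y s : mulv (rowmx j m) (update y j s) =
  update y j (m j * s + \sum_(k | k != j) m k * y k).
Proof.
apply/funext => i; rewrite /mulv {2}/update.
case: (eqVneq i j) => [->|ij].
  rewrite (bigD1 j)//= mxE eqxx {1}/update eqxx; congr (_ + _).
  by apply: eq_bigr => k kj; rewrite mxE eqxx /update (negbTE kj).
rewrite (bigD1 i)//= mxE (negbTE ij) eqxx mul1r /update (negbTE ij).
by rewrite big1 ?addr0// => k ki; rewrite mxE (negbTE ij) eq_sym (negbTE ki) mul0r.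
Qed.

Definition change_of_var T := forall (f : ('I_n -> R) -> \bar R) x,
  coord_measurable f -> (forall x, 0 <= f x)%E ->
  (`|\det T|%:E * iter_int leb (enum 'I_n) (f \o mulv T) x = iter_int leb (enum 'I_n) f x)%E.

(** With coordinate [j] innermost, this is the affine substitution in one
    variable, of slope [m j]. *)
Lemma change_of_var_rowmx j m : m j != 0 -> change_of_var (rowmx j m).
Proof.
move=> mj f x mf f0; rewrite det_rowmx.
have jenum : perm_eq (enum 'I_n) (rcons (rem j (enum 'I_n)) j).
  by rewrite (perm_trans (perm_to_rem (mem_enum _ j)))// perm_sym perm_rcons.
have mfr := coord_measurable_mulv (rowmx j m) mf.
have fr0 y : (0 <= (f \o mulv (rowmx j m)) y)%E by exact: f0.
rewrite !(iter_int_perm _ jenum)// -cats1 !iter_int_cat -iter_int_mule//; last 2 first.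
- exact: coord_measurable_iter_int.
- by move=> y; apply: iter_int_ge0.
congr (iter_int _ _ _ _); apply/funext => y /=.
rewrite /coord_int; under eq_integral do rewrite /= mulv_rowmx_update.
rewrite (integral_affine (f := fun s => f (update y j s)))//.
exact: coord_measurable_update.
Qed.

Lemma change_of_var_mulr T j m : m j != 0 ->
  change_of_var (T *m rowmx j m) -> change_of_var T.
Proof.
move=> mj hTM f x mf f0.
rewrite -(hTM f x mf f0) det_mulmx normrM EFinM -muleA; congr (_ * _)%E.
have fT0 y : (0 <= (f \o mulv T) y)%E by exact: f0.
rewrite -(change_of_var_rowmx mj x (coord_measurable_mulv T mf) fT0).
by congr (_ * iter_int _ _ _ _)%E; apply/funext => y /=; rewrite mulvM.
Qed.

Lemma unitmx_mul_rowmx T j m : m j != 0 -> T \in unitmx -> T *m rowmx j m \in unitmx.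
Proof.
by move=> mj uT; rewrite unitmx_mul uT unitmxE det_rowmx unitfE.
Qed.

(** Column operations turn [T] into the identity one row at a time. The
    induction is on the number of rows, indexed by [Z], that may still differ
    from those of the identity. *)
Lemma linear_change T : T \in unitmx -> change_of_var T.
Proof.
suff : forall k (Z : {set 'I_n}), #|Z| = k -> forall T, T \in unitmx ->
    (forall i, i \notin Z -> forall b, T i b = (i == b)%:R) -> change_of_var T.
  move=> + uT => /(_ _ [set: 'I_n]%SET erefl T uT); apply=> i.
  by rewrite finset.in_setT.
elim => [|k ih] Z Zk {}T uT TZ.
  have -> : T = 1%:M.
    by apply/matrixP => i b; rewrite TZ ?mxE// (cards0_eq Zk) inE.
  move=> f x mf f0; rewrite det1 normr1 mul1e; congr (iter_int _ _ _ _).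
  by apply/funext => y /=; rewrite mulv1.
have [j jZ] : exists j, j \in Z by apply/set0Pn; rewrite -card_gt0 Zk.
have main T' : T' \in unitmx ->
    (forall i, i \notin Z -> forall b, T' i b = (i == b)%:R) -> T' j j != 0 ->
    change_of_var T'.
  move=> uT' T'Z Tjj.
(* clears row j with the pivot T' j j; the finished rows vanish in column j
   and are kept *)
  pose m b := if b == j then (T' j j)^-1 else - (T' j b / T' j j).
  have mj : m j != 0 by rewrite /m eqxx invr_eq0.
  apply: (change_of_var_mulr mj); apply: (ih (Z :\ j)).
  - by apply/eqP; rewrite -eqSS -Zk (cardsD1 j Z) jZ.
  - exact: unitmx_mul_rowmx.
  move=> i; rewrite !inE negb_and negbK => /orP[/eqP ->|iZ] b.
    rewrite mulmx_rowmx /m (eq_sym b); case: (eqVneq j b) => jb.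
      by rewrite add0r divff.
    by rewrite mulrN mulrCA divff// mulr1 subrr.
  rewrite mulmx_rowmx !T'Z//; have ij : i != j by apply: contraNneq iZ => ->.
  rewrite (negbTE ij) mul0r addr0; case: (eqVneq b j) => // bj.
  by rewrite bj (negbTE ij).
have [Tjj|] := eqVneq (T j j) 0; last exact: main.
(* If row j vanished on Z it would be a combination of finished rows; v is the
   corresponding linear relation between the rows of T. *)
have [k' k'Z Tjk] : exists2 k', k' \in Z & T j k' != 0.
  apply/exists_inP; apply: contraT => /exists_inPn h.
  pose v : 'rV[R]_n := \row_b ((b == j)%:R - (b \notin Z)%:R * T j b).
  have vT : v *m T = 0.
    apply/rowP => b; rewrite !mxE.
    under eq_bigr do rewrite mxE mulrBl.
    rewrite sumrB (bigD1 j)//= eqxx mul1r big1 => [|i ij]; last first.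
      by rewrite (negbTE ij) mul0r.
    rewrite addr0; apply/eqP; rewrite subr_eq0; apply/eqP.
    case: (boolP (b \in Z)) => bZ.
      have /negPn/eqP -> := h _ bZ; rewrite big1// => i _.
      case: (boolP (i \in Z)) => iZ; first by rewrite !mul0r.
      rewrite (TZ i)//; case: (eqVneq i b) => [ib|_]; last by rewrite mulr0.
      by rewrite ib bZ in iZ.
    rewrite (bigD1 b)//= bZ mul1r (TZ b)// eqxx mulr1 big1 ?addr0// => i ib.
    case: (boolP (i \in Z)) => iZ; first by rewrite !mul0r.
    by rewrite (TZ i)// (negbTE ib) mulr0.
  have : v 0 j = 0.
    by rewrite -[v](mulmxK uT) vT mul0mx mxE.
  by rewrite mxE eqxx jZ mul0r subr0 => /eqP; rewrite oner_eq0.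
have k'j : k' != j by apply: contraNneq Tjk => ->; rewrite Tjj.
(* adding column k' to column j makes the pivot nonzero *)
pose m b : R := ((b == j) || (b == k'))%:R.
have mk : m k' != 0 by rewrite /m eqxx orbT oner_eq0.
apply: (change_of_var_mulr mk); apply: main.
- exact: unitmx_mul_rowmx.
- move=> i iZ b; rewrite mulmx_rowmx !TZ//.
  have ik : i != k' by apply: contraNneq iZ => ->.
  rewrite (negbTE ik) mul0r addr0; case: (eqVneq b k') => // bk.
  by rewrite bk (negbTE ik).
- by rewrite mulmx_rowmx (eq_sym j k') (negbTE k'j) Tjj add0r /m eqxx mulr1.
Qed.

End linear_change.

Section block_change.
Context {R : realType}.
Local Notation leb := (@lebesgue_measure R).
Variables (I : eqType) (n : nat) (e : 'I_n -> I).
Hypothesis e_inj : injective e.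

Definition act_coords (T : 'M[R]_n) (x : I -> R) : I -> R := glue e x (mulv T (x \o e)).

Lemma linear_change_block T f x : T \in unitmx -> coord_measurable f -> (forall x, 0 <= f x)%E ->
  (`|\det T|%:E * iter_int leb (map e (enum 'I_n)) (f \o act_coords T) x =
   iter_int leb (map e (enum 'I_n)) f x)%E.
Proof.
move=> uT mf f0.
rewrite (iter_int_map e_inj leb (enum 'I_n) (f \o act_coords T)) (iter_int_map e_inj leb (enum 'I_n) f).
have g0 y : (0 <= (f \o glue e x) y)%E by exact: f0.
apply: etrans (linear_change uT (x \o e) (coord_measurable_glue e x mf) g0).
congr (_ * iter_int _ _ _ _)%E; apply/funext => y /=; congr f.
rewrite /act_coords glue_glue; congr (glue _ _ (mulv _ _)).
by apply/funext => j /=; rewrite glueE.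
Qed.

End block_change.

(** * Gaussian and Lebesgue iterated integrals *)

Section densities.
Context {R : realType}.
Local Notation leb := (@lebesgue_measure R).
Local Notation gam := (@normal_prob R 0 1).
Local Notation phi := (@normal_pdf R 0 1).
Local Notation peak := (@normal_peak R 1).
Variable I : eqType.
Implicit Types (x : I -> R) (l : seq I).

Lemma iter_intM mu l (f : (I -> R) -> \bar R) (g : (I -> R) -> R) x :
  coord_measurable f -> (forall x, 0 <= f x)%E -> (forall x, 0 <= g x) ->
  (forall x i s, i \in l -> g (update x i s) = g x) ->
  (iter_int mu l (fun y => f y * (g y)%:E) x = iter_int mu l f x * (g x)%:E)%E.
Proof.
move=> mf f0 g0; elim: l x => [|i l ih] x gl //=.
rewrite /coord_int.
under eq_integral => s _.
  rewrite ih; last by move=> y j t jl; rewrite gl// inE jl orbT.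
  rewrite gl ?mem_head//; over.
rewrite ge0_integralZr//.
- by apply: coord_measurable_update; exact: coord_measurable_iter_int.
- by move=> s _; exact: iter_int_ge0.
- by rewrite lee_fin.
Qed.

Lemma iter_int_normal l (f : (I -> R) -> \bar R) x : uniq l ->
  coord_measurable f -> (forall x, 0 <= f x)%E ->
  (iter_int gam l f x = iter_int leb l (fun y => f y * (\prod_(i <- l) phi (y i))%:E) x)%E.
Proof.
move=> + mf f0; elim: l x => [|i l ih] x /=.
  by rewrite big_nil mule1.
move=> /andP[il ul]; rewrite /coord_int integral_normal_prob; last 2 first.
- by apply: coord_measurable_update; exact: coord_measurable_iter_int.
- by move=> s; exact: iter_int_ge0.
apply: eq_integral => s _; rewrite ih//.
rewrite (_ : phi s = (fun y : I -> R => phi (y i)) (update x i s)); last first.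
  by rewrite /= /update eqxx.
rewrite -(@iter_intM leb l (fun y => f y * (\prod_(i <- l) phi (y i))%:E)%E
  (fun y => phi (y i))).
- apply: (congr1 (fun h => iter_int leb l h (update x i s))); apply/funext => y.
  by rewrite big_cons -muleA -EFinM (mulrC (phi _)).
- move=> d U g mg; apply: emeasurable_funM; first exact: mf.
  apply/measurable_EFinP; apply: measurable_prod => k _.
  by apply: measurableT_comp => //; exact: measurable_normal_pdf.
- by move=> y; rewrite mule_ge0// lee_fin prodr_ge0// => k _; exact: normal_pdf_ge0.
- by move=> y; exact: normal_pdf_ge0.
- move=> y j t jl; rewrite /update.
  by case: eqP => // ij; move: il; rewrite ij jl.
Qed.

(** The Gaussian density is at most its peak, in each coordinate. *)
Lemma iter_int_normal_le l (f : (I -> R) -> \bar R) x :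
  coord_measurable f -> (forall x, 0 <= f x)%E ->
  (iter_int gam l f x <= (peak ^+ size l)%:E * iter_int leb l f x)%E.
Proof.
move=> mf f0; elim: l x => [|i l ih] x /=; first by rewrite mul1e.
have p0 : 0 <= peak ^+ size l by rewrite exprn_ge0// normal_peak_ge0.
have mi := coord_measurable_iter_int leb l mf f0.
have i0 y := iter_int_ge0 leb l y f0.
apply: (@le_trans _ _ (coord_int gam i (fun y => (peak ^+ size l)%:E * iter_int leb l f y)%E x)).
  apply: le_coord_int => //.
  - exact: coord_measurable_iter_int.
  - by move=> d U g mg; apply: measurable_funeM; exact: mi.
  - by move=> y; exact: iter_int_ge0.
rewrite coord_intZl// exprSr EFinM -muleA lee_wpmul2l//.
have mu1 := coord_measurable_update x i mi.
rewrite /coord_int integral_normal_prob// -ge0_integralZl_EFin//; last exact: normal_peak_ge0.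
apply: ge0_le_integral => //.
- by move=> s _; rewrite mule_ge0// lee_fin normal_pdf_ge0.
- apply: emeasurable_funM => //.
  by apply/measurable_EFinP; exact: measurable_normal_pdf.
- by apply: measurable_funeM.
- move=> s _; rewrite muleC lee_wpmul2r// lee_fin.
  by apply: normal_pdf_ub; rewrite oner_eq0.
Qed.

End densities.

(** * The Gamma function, the Cauchy density and the volume of projective space *)

Section gamma.
Context {R : realType}.
Local Notation leb := (@lebesgue_measure R).
Local Notation smeas := {sigma_finite_measure set (measurableTypeR R) -> \bar R}.

Lemma iter_int_prod (I : eqType) (mu : smeas) (l : seq I) (h : I -> R -> R) (c : R) x :
  uniq l -> (forall i, measurable_fun setT (h i)) -> (forall i s, 0 <= h i s) ->
  (forall i, \int[mu]_s (h i s)%:E = c%:E)%E ->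
  (iter_int mu l (fun y => (\prod_(i <- l) h i (y i))%:E) x = (c ^+ size l)%:E)%E.
Proof.
move=> + mh h0 hc; elim: l x => [|i l ih] x /=; first by rewrite big_nil.
move=> /andP[il ul].
have mp (l' : seq I) : coord_measurable (fun y : I -> R => (\prod_(i <- l') h i (y i))%:E).
  move=> d U g mg; apply/measurable_EFinP; apply: measurable_prod => j _.
  by apply: measurableT_comp.
rewrite (_ : (fun y => _) = fun y => ((\prod_(i <- l) h i (y i))%:E * (h i (y i))%:E)%E); last first.
  by apply/funext => y; rewrite big_cons mulrC EFinM.
rewrite /coord_int; under eq_integral => s _.
  rewrite (@iter_intM R I mu l (fun y => (\prod_(i <- l) h i (y i))%:E) (fun y => h i (y i)))//; last 2 first.
  - by move=> y; rewrite lee_fin prodr_ge0.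
  - move=> y j t jl; rewrite /update.
    by case: eqP => // ij; move: il; rewrite ij jl.
  rewrite ih// /update eqxx; over.
rewrite ge0_integralZl_EFin//.
- by rewrite hc exprSr EFinM.
- by move=> s _; rewrite lee_fin.
- by apply/measurable_EFinP; exact: mh.
- rewrite exprn_ge0// -lee_fin -(hc i); apply: integral_ge0 => s _.
  by rewrite lee_fin.
Qed.

(** Extended by 0 to the whole line, where affine substitutions are available. *)
Definition gamma_density (a x : R) : R := if 0 < x then x `^ (a - 1) * expR (- x) else 0.

Definition gamma_int (a : R) : \bar R := (\int[leb]_x (gamma_density a x)%:E)%E.

Lemma Gamma_fine a : Gamma a = fine (gamma_int a).
Proof.
rewrite /Gamma /Rintegral /gamma_int integral_mkcond; congr fine.
apply: eq_integral => x _; rewrite patchE /gamma_density; case: ifPn.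
  by rewrite inE/= in_itv/= andbT => ->.
by rewrite notin_setE/= in_itv/= andbT; case: ltP.
Qed.

Lemma gamma_density_ge0 a x : 0 <= gamma_density a x.
Proof. by rewrite /gamma_density; case: ifP => // _; rewrite mulr_ge0// ?powR_ge0// expR_ge0. Qed.

Lemma measurable_pos_if d (U : measurableType d) (h k : U -> R) :
  measurable_fun setT h -> measurable_fun setT k ->
  measurable_fun setT (fun u => if 0 < h u then k u else 0).
Proof.
move=> mh mk; apply: measurable_fun_ifT => //.
by apply: measurable_fun_ltr => //; exact: measurable_cst.
Qed.

Lemma measurable_powR_comp d (U : measurableType d) (h : U -> R) a :
  measurable_fun setT h -> measurable_fun setT (fun u => h u `^ a).
Proof. by move=> mh; apply: (measurableT_comp (measurable_powR a)). Qed.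

Lemma measurable_gamma_density a : measurable_fun setT (gamma_density a).
Proof.
apply: measurable_pos_if => //; apply: measurable_funM.
  exact: measurable_powR_comp.
by apply: measurableT_comp => //; exact: measurable_funN.
Qed.

Lemma gamma_int_ge0 a : (0 <= gamma_int a)%E.
Proof. by apply: integral_ge0 => x _; rewrite lee_fin gamma_density_ge0. Qed.

Lemma gamma_scale a b : 0 < b ->
  (\int[leb]_x (if 0 < x then x `^ (a - 1) * expR (- (b * x)) else 0)%:E =
   (b `^ (- a))%:E * gamma_int a)%E.
Proof.
move=> b0; have b1 : b != 0 by rewrite gt_eqF.
rewrite /gamma_int -(@integral_affine R (fun x => (gamma_density a x)%:E) b 0)//; last 2 first.
- by apply/measurable_EFinP; exact: measurable_gamma_density.
- by move=> x; rewrite lee_fin gamma_density_ge0.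
rewrite gtr0_norm// muleA -EFinM -ge0_integralZl_EFin//; last 3 first.
- by move=> x _; rewrite lee_fin gamma_density_ge0.
- apply/measurable_EFinP; apply: (measurableT_comp (measurable_gamma_density a)).
  by apply: measurable_funD => //; exact: measurable_funM.
- by rewrite mulr_ge0// ?powR_ge0// ltW.
apply: eq_integral => x _; rewrite -EFinM; congr (_%:E).
rewrite /gamma_density addr0 pmulr_rgt0//; case: ifPn => x0; last by rewrite mulr0.
have bb : b `^ (- a) * (b * b `^ (a - 1)) = 1.
  rewrite -{2}(powRr1 (ltW b0)) -!powRD ?b1 ?implybT//.
  by rewrite (_ : - a + (1 + (a - 1)) = 0) ?powRr0//; ring.
rewrite powRM ?ltW// -[LHS]mul1r -{1}bb; ring.
Qed.

Lemma gauss_scale b : 0 < b ->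
  (\int[leb]_x (expR (- (b * x ^+ 2)))%:E = (Num.sqrt (pi / b))%:E)%E.
Proof.
move=> b0; have sb : Num.sqrt b != 0 by rewrite gt_eqF// sqrtr_gt0.
have mg : measurable_fun [set: R] (fun x => (gauss_fun x)%:E).
  by apply/measurable_EFinP; exact: measurable_gauss_fun.
have g0 x : (0 <= (gauss_fun x)%:E :> \bar R)%E by rewrite lee_fin gauss_fun_ge0.
have := integral_affine 0 sb mg g0; rewrite integralT_gauss => h.
rewrite sqrtrM ?pi_ge0// sqrtrV ?ltW// mulrC EFinM -h muleA -EFinM.
rewrite ger0_norm ?sqrtr_ge0// mulVf// mul1e; apply: eq_integral => x _.
by rewrite /gauss_fun addr0 exprMn sqr_sqrtr// ltW.
Qed.

Definition sqn n (u : 'I_n -> R) : R := \sum_i u i ^+ 2.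

Lemma sqn_ge0 n (u : 'I_n -> R) : 0 <= sqn u.
Proof. by apply: sumr_ge0 => i _; exact: sqr_ge0. Qed.

Lemma measurable_sqn d (U : measurableType d) n (g : U -> 'I_n -> R) :
  (forall i, measurable_fun setT (g^~ i)) -> measurable_fun setT (fun u => sqn (g u)).
Proof. by move=> mg; apply: measurable_sum => i; exact: measurable_funX. Qed.

(** The unnormalized multivariate Cauchy density. *)
Definition cauchy n (u : 'I_n -> R) : R := (1 + sqn u) `^ (- (n.+1%:R / 2)).

Definition cauchy_int n : \bar R :=
  iter_int leb (enum 'I_n) (fun u => (cauchy u)%:E) (fun=> 0).

Lemma gauss_sqn n b x : 0 < b ->
  (iter_int leb (enum 'I_n) (fun u => (expR (- (b * sqn u)))%:E) x = (Num.sqrt (pi / b) ^+ n)%:E)%E.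
Proof.
move=> b0; rewrite -[in RHS](size_enum_ord n).
rewrite -(@iter_int_prod _ leb _ (fun _ s => expR (- (b * s ^+ 2))) _ x) ?enum_uniq//.
- congr (iter_int _ _ _ _); apply/funext => u; congr (_%:E).
  by rewrite big_enum/= -expR_sum sumrN -mulr_sumr.
- by move=> i; apply: measurableT_comp => //; apply: measurable_funN; apply: measurable_funM => //; exact: measurable_funX.
- by move=> i; exact: gauss_scale.
Qed.

(** Integrate x^(a-1) exp (-(1 + |u|^2) x), where a = (n+1)/2, over positive [x]
    and over [u], in both orders. Over [x] first one gets a Gamma integral, over
    [u] first a Gaussian one. *)
Lemma gamma_cauchy n : (gamma_int (n.+1%:R / 2) * cauchy_int n =
  (Num.sqrt pi ^+ n)%:E * gamma_int (2^-1))%E.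
Proof.
set a := n.+1%:R / 2.
have mc : coord_measurable (fun u : 'I_n -> R => (cauchy u)%:E).
  move=> d U g mg; apply/measurable_EFinP; apply: measurable_powR_comp.
  by apply: measurable_funD => //; exact: measurable_sqn.
have c0 (u : 'I_n -> R) : (0 <= (cauchy u)%:E)%E by rewrite lee_fin powR_ge0.
pose k (x : R) (u : 'I_n -> R) : \bar R :=
  (if 0 < x then x `^ (a - 1) * expR (- ((1 + sqn u) * x)) else 0)%:E.
have k0 x u : (0 <= k x u)%E.
  by rewrite /k lee_fin; case: ifP => // _; rewrite mulr_ge0 ?powR_ge0 ?expR_ge0.
have mk : param_measurable (k : measurableTypeR R -> _).
  move=> d U h g mh mg; apply/measurable_EFinP; apply: measurable_pos_if => //.
  apply: measurable_funM; first exact: measurable_powR_comp.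
  apply: measurableT_comp => //; apply: measurable_funN; apply: measurable_funM => //.
  by apply: measurable_funD => //; exact: measurable_sqn.
transitivity (\int[leb]_x iter_int leb (enum 'I_n) (k x) (fun=> 0%R))%E.
  rewrite (integral_iter_intC leb leb (enum 'I_n) (f := k))// muleC muleC /cauchy_int.
  rewrite -iter_int_mule//; last exact: gamma_int_ge0.
  congr (iter_int _ _ _ _); apply/funext => u; rewrite /k gamma_scale 1?muleC//.
  by rewrite (lt_le_trans ltr01)// lerDl sqn_ge0.
rewrite -ge0_integralZl_EFin//; last 2 first.
- by move=> x _; rewrite lee_fin gamma_density_ge0.
- by apply/measurable_EFinP; exact: measurable_gamma_density.
apply: eq_integral => x _; rewrite /gamma_density; case: ltP => x0; last first.
  rewrite mule0 /k ltNge x0 /= (_ : (fun=> 0%E) = fun u => (0%:E * 0%:E)%E).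
    by rewrite iter_int_mule ?mul0e//; move=> d U g mg; exact: measurable_cst.
  by apply/funext => u; rewrite mul0e.
rewrite /k x0.
rewrite (_ : (fun u => _) = fun u : 'I_n -> R => ((x `^ (a - 1) * expR (- x))%:E * (expR (- (x * sqn u)))%:E)%E).
  rewrite iter_int_mule; last 3 first.
  - by rewrite lee_fin mulr_ge0 ?powR_ge0 ?expR_ge0.
  - move=> d U g mg; apply/measurable_EFinP; apply: measurableT_comp => //.
    by apply: measurable_funN; apply: measurable_funM => //; exact: measurable_sqn.
  - by move=> u; rewrite lee_fin expR_ge0.
  rewrite gauss_sqn// -!EFinM; congr (_%:E).
  rewrite sqrtrM ?pi_ge0// exprMn sqrtrV ?(ltW x0)//.
  rewrite -(powR12_sqrt (ltW x0)) -powRN -(powR_mulrn n (powR_ge0 x (- 2^-1))) -powRrM.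
  rewrite mulrA [LHS](_ : _ = Num.sqrt pi ^+ n * ((x `^ (a - 1) * x `^ (- 2^-1 * n%:R)) * expR (- x))); last by ring.
  rewrite -powRD ?(gt_eqF x0) ?implybT//; congr (_ * (_ `^ _ * _)).
  by rewrite /a -natr1; field.
apply/funext => u; rewrite -EFinM -mulrA -expRD; congr ((_ * expR _)%:E).
by ring.
Qed.

Lemma gamma_int1 : gamma_int 1 = 1%E.
Proof.
rewrite -(integral_exponential_pdf (@ltr01 R)) /gamma_int.
transitivity (\int[leb]_(x in `]0%R, +oo[) (expR (- x))%:E)%E.
  rewrite [RHS]integral_mkcond; apply: eq_integral => x _.
  rewrite patchE /gamma_density mem_setE in_itv/= andbT subrr powRr0 mul1r.
  by case: ifP.
rewrite integral_itv_obnd_cbnd; last first.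
  by apply/measurable_EFinP; apply: measurableT_comp => //; exact: measurable_funN.
rewrite [LHS]integral_mkcond; apply: eq_integral => x _.
rewrite patchE mem_setE in_itv/= andbT.
case: leP => x0; last by rewrite lt0_exponential_pdf.
by rewrite exponential_pdfE// mul1r mulN1r.
Qed.

(** On the line this is the integral of 1 / (1 + x^2). *)
Lemma cauchy_int1 : cauchy_int 1 = pi%:E.
Proof.
rewrite /cauchy_int enum_ordSl /= (size0nil (size_enum_ord 0)) /= /coord_int.
transitivity (\int[leb]_x ((oneDsqr x)^-1)%:E)%E.
  apply: eq_integral => x _; rewrite /cauchy /sqn big_ord1 /update eqxx divff//.
  by rewrite powRN powRr1// addr_ge0// sqr_ge0.
rewrite ge0_symfun_integralT//.
- rewrite (_ : [set x | _] = `[0, +oo[%classic); last first.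
    by apply/seteqP; split => x/=; rewrite in_itv/= andbT.
  by rewrite integral0y_oneDsqr -EFinM mulrCA divff ?mulr1.
- exact: continuous_oneDsqrV.
- by move=> x /=; rewrite /oneDsqr sqrrN.
Qed.

(** The case n = 1 of [gamma_cauchy], where the Cauchy integral is known. *)
Lemma gamma_int_half : gamma_int 2^-1 = (Num.sqrt pi)%:E.
Proof.
have := gamma_cauchy 1; rewrite divff// gamma_int1 mul1e cauchy_int1 expr1.
have sp : 0 < Num.sqrt (pi : R) by rewrite sqrtr_gt0 pi_gt0.
have := gamma_int_ge0 2^-1; case: (gamma_int _) => [g _|_|//].
  rewrite -EFinM => -[h]; congr (_%:E); apply: (mulfI (lt0r_neq0 sp)).
  by rewrite -h -expr2 sqr_sqrtr// pi_ge0.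
by rewrite gt0_muley.
Qed.

Lemma cauchy_int_ge0 n : (0 <= cauchy_int n)%E.
Proof. by apply: iter_int_ge0 => u; rewrite lee_fin powR_ge0. Qed.

(** In the affine chart of projective space that projects from the centre onto
    a hyperplane, the Cauchy density is the density of the volume. The
    computation divides [gamma_cauchy] by the Gamma integral, which is finite
    and positive because the product is. *)
Lemma cauchy_intE n : 0 < vol_proj R n /\ cauchy_int n = (vol_proj R n)%:E.
Proof.
have p0 : 0 < Num.sqrt (pi : R) ^+ n.+1 by rewrite exprn_gt0// sqrtr_gt0 pi_gt0.
have := gamma_cauchy n; rewrite gamma_int_half -EFinM -exprSr.
rewrite /vol_proj Gamma_fine.
have -> : (pi : R) `^ (n.+1%:R / 2) = Num.sqrt pi ^+ n.+1.
  rewrite -(powR12_sqrt (pi_ge0 R)) -(powR_mulrn n.+1 (powR_ge0 _ _)) -powRrM.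
  by rewrite mulrC.
have := cauchy_int_ge0 n; have := gamma_int_ge0 (n.+1%:R / 2).
case: (gamma_int _) => [g|_|//]; [rewrite lee_fin => g0|];
  case: (cauchy_int n) => [c|_|//]; rewrite ?lee_fin.
- move=> c0 -[h].
  have gp : 0 < g by rewrite lt_neqAle g0 andbT; apply: contraTneq p0 => g1; rewrite -h -g1 mul0r ltxx.
  by rewrite divr_gt0//; split => //; congr (_%:E); rewrite -h mulrAC divff ?mul1r// gt_eqF.
- move: g0; rewrite le_eqVlt => /predU1P[<-|g0].
    by rewrite mul0e => -[h]; rewrite -h ltxx in p0.
  by rewrite gt0_muley.
- rewrite le_eqVlt => /predU1P[<-|c0].
    by rewrite mule0 => -[h]; rewrite -h ltxx in p0.
  by rewrite gt0_mulye.
- by rewrite mulyy.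
Qed.

(** The substitution s = d - x turns this into the exponential density. *)
Lemma integral_expR_ray (d : R) :
  (\int[leb]_s (if 0 < d - s then expR s else 0)%:E = (expR d)%:E)%E.
Proof.
have mg : measurable_fun [set: R] (fun x => (gamma_density 1 x)%:E).
  by apply/measurable_EFinP; exact: measurable_gamma_density.
have g0 x : (0 <= (gamma_density 1 x)%:E :> \bar R)%E.
  by rewrite lee_fin gamma_density_ge0.
have N1 : (-1 : R) != 0 by rewrite oppr_eq0 oner_eq0.
have := integral_affine d N1 mg g0.
rewrite [X in _ = X]gamma_int1 normrN1 mul1e => h.
rewrite -[RHS]mule1 -h -ge0_integralZl_EFin//; last first.
  apply/measurable_EFinP; apply: (measurableT_comp (measurable_gamma_density 1)).
  by apply: measurable_funD => //; exact: measurable_funM.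
apply: eq_integral => s _; rewrite -EFinM /gamma_density mulN1r addrC.
case: ifP => _; last by rewrite mulr0.
by rewrite subrr powRr0 mul1r -expRD; congr ((expR _)%:E); ring.
Qed.

End gamma.

(** * The expected absolute determinant of a Gaussian matrix *)

Section rank_one.
Context {F : comPzRingType}.

(** Two block triangular factorizations of the matrix with blocks 1, v, w, 1. *)
Lemma det_rank_one_update n (w : 'cV[F]_n) (v : 'rV[F]_n) :
  \det (1%:M - w *m v) = 1 - (v *m w) 0 0.
Proof.
pose M : 'M[F]_(1 + n) := block_mx 1%:M v w 1%:M.
have M1 : M = block_mx 1%:M 0 w 1%:M *m block_mx 1%:M v 0 (1%:M - w *m v).
  by rewrite mulmx_block !mul1mx !mulmx1 !mul0mx !addr0 addrC subrK.
have M2 : M = block_mx 1%:M v 0 1%:M *m block_mx (1%:M - v *m w) 0 w 1%:M.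
  by rewrite mulmx_block !mul1mx !mulmx1 !mul0mx !add0r subrK.
transitivity (\det M).
  by rewrite M1 det_mulmx det_lblock det_ublock !det1 !mul1r.
by rewrite M2 det_mulmx det_ublock det_lblock !det1 !mul1r mulr1 det_mx11 !mxE.
Qed.

End rank_one.

Section whitening.
Context {R : realType}.
Variables (n : nat) (u : 'I_n -> R).

Definition sqrt_1Dsqn : R := Num.sqrt (1 + sqn u).
Local Notation q := sqrt_1Dsqn.

Lemma sqrt_1Dsqn_gt0 : 0 < q.
Proof. by rewrite sqrtr_gt0 (lt_le_trans ltr01)// lerDl sqn_ge0. Qed.

Definition rowu : 'rV[R]_n := \row_j u j.

(** The inverse square root of 1 + u^T u, explicit because of the rank one. *)
Definition whitening : 'M[R]_n := 1%:M - (q * (q + 1))^-1 *: (rowu^T *m rowu).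

Lemma rowu_sqn : rowu *m rowu^T = (sqn u)%:M.
Proof.
apply/matrixP => i j; rewrite !ord1 !mxE eqxx mulr1n.
by apply: eq_bigr => k _; rewrite !mxE expr2.
Qed.

Lemma sqn_q : sqn u = q ^+ 2 - 1.
Proof. by rewrite sqr_sqrtr ?addr_ge0 ?sqn_ge0// addrAC subrr add0r. Qed.

Lemma det_whitening : \det whitening = q^-1.
Proof.
have q0 := sqrt_1Dsqn_gt0.
rewrite /whitening scalemxAl det_rank_one_update -scalemxAr rowu_sqn.
rewrite !mxE eqxx mulr1n sqn_q.
by field; rewrite !gt_eqF//= addr_gt0.
Qed.

Lemma whiteningP : whitening *m (1%:M + rowu^T *m rowu) *m whitening^T = 1%:M.
Proof.
have q0 := sqrt_1Dsqn_gt0.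
set A := rowu^T *m rowu; set b := (q * (q + 1))^-1.
have AA : A *m A = sqn u *: A.
  by rewrite /A mulmxA -(mulmxA _ rowu) rowu_sqn mul_mx_scalar -scalemxAl.
have At : A^T = A by rewrite /A trmx_mul trmxK.
have polyA a c : (1%:M + a *: A) *m (1%:M + c *: A) =
    1%:M + (a + c + a * c * sqn u) *: A.
  rewrite mulmxDr mulmx1 mulmxDl mul1mx -scalemxAl -scalemxAr AA !scalerA.
  by rewrite !scalerDl !addrA.
have -> : whitening = 1%:M + (- b) *: A by rewrite /whitening scaleNr.
have -> : (1%:M + (- b) *: A)^T = 1%:M + (- b) *: A.
  by apply/matrixP => i j; have := congr1 (fun M : 'M[R]_n => M i j) At; rewrite !mxE (eq_sym j) => ->.
rewrite -{2}(scale1r A) !polyA.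
rewrite [X in X *: A](_ : _ = 0) ?scale0r ?addr0// sqn_q /b.
by field; rewrite !gt_eqF//= addr_gt0.
Qed.

End whitening.

Section gaussian_determinant.
Context {R : realType}.
Local Notation leb := (@lebesgue_measure R).
Local Notation gam := (@normal_prob R 0 1).
Local Notation phi := (@normal_pdf R 0 1).
Local Notation peak := (@normal_peak R 1).
Variable n : nat.
Local Notation N2 := ('I_n * 'I_n)%type.
Implicit Types (x : N2 -> R) (S : 'M[R]_n) (u : 'I_n -> R).

Definition mx_of_pairs x : 'M[R]_n := \matrix_(i, j) x (i, j).

Lemma measurable_det d (U : measurableType d) m (g : U -> 'M[R]_m) :
  (forall i j, measurable_fun setT (fun a => g a i j)) ->
  measurable_fun setT (fun a => \det (g a)).
Proof.
move=> mg; apply: measurable_sum => s; apply: measurable_funM => //.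
by apply: measurable_prod => i _.
Qed.

Lemma measurable_phi d (U : measurableType d) (h : U -> R) :
  measurable_fun setT h -> measurable_fun setT (fun a => phi (h a)).
Proof. by move=> mh; apply: (measurableT_comp (measurable_normal_pdf 0 1)). Qed.

Lemma phiE s : phi s = peak * expR (- (s ^+ 2 / 2)).
Proof.
by rewrite normal_pdfE ?oner_eq0// /normal_fun subr0 expr1n mulNr.
Qed.

(** Multiplication by [S] on the right, on the rows with index in [l] only: the
    change of variables is carried out row by row. *)
Definition rowsact S (l : seq 'I_n) x : N2 -> R :=
  fun p => if p.1 \in l then \sum_k x (p.1, k) * S k p.2 else x p.

Lemma coord_measurable_rowsact S l f : coord_measurable f -> coord_measurable (f \o rowsact S l).
Proof.
move=> mf d U g mg; apply: mf => p; rewrite /rowsact.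
case: (p.1 \in l) => //; apply: measurable_sum => k.
by apply: measurable_funM => //; exact: measurable_cst.
Qed.

Lemma rowsact1E S i x : rowsact S [:: i] x = act_coords (pair i) S^T x.
Proof.
apply/funext => -[a b]; rewrite /rowsact /act_coords /= inE.
have [->|ai] := eqVneq a i.
  rewrite glueE; last by move=> j k [].
  by apply: eq_bigr => k _; rewrite mxE mulrC.
by rewrite glueN// => j; apply: contraNneq ai => -[->].
Qed.

Lemma linear_change_row S i f x : S \in unitmx -> coord_measurable f -> (forall x, 0 <= f x)%E ->
  (`|\det S|%:E * iter_int leb (enum {: N2}) (f \o rowsact S [:: i]) x =
   iter_int leb (enum {: N2}) f x)%E.
Proof.
move=> uS mf f0.
have pe : perm_eq (enum {: N2})
    ([seq p <- enum {: N2} | p.1 != i] ++ map (pair i) (enum 'I_n)).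
  apply: uniq_perm; first exact: enum_uniq.
    rewrite cat_uniq filter_uniq ?enum_uniq//= map_inj_uniq ?enum_uniq; last by move=> ? ? [].
    rewrite andbT; apply/hasPn => _ /mapP[j _ ->] /=.
    by rewrite mem_filter /= eqxx.
  move=> [a b]; rewrite mem_enum mem_cat mem_filter mem_enum /= andbT.
  case: (eqVneq a i) => //= ->; apply/esym/mapP; exists b => //.
  by rewrite mem_enum.
have mfr := coord_measurable_rowsact S [:: i] mf.
have fr0 y : (0 <= (f \o rowsact S [:: i]) y)%E by exact: f0.
rewrite (iter_int_perm leb pe mfr fr0) (iter_int_perm leb pe mf f0) !iter_int_cat.
rewrite -iter_int_mule//; last 2 first.
- exact: coord_measurable_iter_int.
- by move=> y; exact: iter_int_ge0.
congr (iter_int _ _ _ _); apply/funext => y.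
have pi_inj : injective (pair i : 'I_n -> N2) by move=> j k [].
have uSt : S^T \in unitmx by rewrite unitmx_tr.
rewrite -(linear_change_block pi_inj y uSt mf f0) det_tr.
by congr (_ * iter_int _ _ _ _)%E; apply/funext => z /=; rewrite rowsact1E.
Qed.

Lemma linear_change_rows S l f x : S \in unitmx -> uniq l -> coord_measurable f -> (forall x, 0 <= f x)%E ->
  ((`|\det S| ^+ size l)%:E * iter_int leb (enum {: N2}) (f \o rowsact S l) x =
   iter_int leb (enum {: N2}) f x)%E.
Proof.
move=> uS; elim: l f => [|i l ih] f /=.
  by rewrite mul1e => _ mf f0; congr (iter_int _ _ _ _); apply/funext.
move=> /andP[il ul] mf f0.
rewrite -(linear_change_row i x uS mf f0).
have mfr := coord_measurable_rowsact S [:: i] mf.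
have fr0 y : (0 <= (f \o rowsact S [:: i]) y)%E by exact: f0.
rewrite -(ih (f \o rowsact S [:: i]) ul mfr fr0).
rewrite exprS EFinM -muleA; congr (_ * (_ * iter_int _ _ _ _))%E.
apply/funext => y /=; congr f; apply/funext => -[a b].
rewrite /rowsact /= !inE; case: (eqVneq a i) => //= ->.
by rewrite (negbTE il).
Qed.

Definition absdet_int : \bar R :=
  iter_int gam (enum {: N2}) (fun x => `|\det (mx_of_pairs x)|%:E) (fun=> 0).

Lemma coord_measurable_absdet : coord_measurable (fun x => `|\det (mx_of_pairs x)|%:E).
Proof.
move=> d U g mg; apply/measurable_EFinP; apply: measurableT_comp => //.
by apply: measurable_det => i j; under eq_fun do rewrite mxE; exact: mg.
Qed.

(** Given the matrix G = [mx_of_pairs x], the density at [u] of the solution of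
    G u = g for a standard Gaussian vector g. *)
Definition kac_density x u : \bar R :=
  (`|\det (mx_of_pairs x)| * \prod_i phi (mulv (mx_of_pairs x) u i))%:E.

Lemma kac_density_ge0 x u : (0 <= kac_density x u)%E.
Proof.
rewrite lee_fin mulr_ge0// prodr_ge0// => i _; exact: normal_pdf_ge0.
Qed.

Lemma measurable_kac_density d (U : measurableType d) (h : U -> N2 -> R)
    (g : U -> 'I_n -> R) :
  (forall p, measurable_fun setT (h^~ p)) -> (forall i, measurable_fun setT (g^~ i)) ->
  measurable_fun setT (fun a => kac_density (h a) (g a)).
Proof.
move=> mh mg; apply/measurable_EFinP; apply: measurable_funM.
  apply: measurableT_comp => //.
  by apply: measurable_det => i j; under eq_fun do rewrite mxE; exact: mh.
apply: measurable_prod => i _; apply: measurable_phi; apply: measurable_sum => k.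
by apply: measurable_funM => //; under eq_fun do rewrite mxE; exact: mh.
Qed.

(** The integral of a density if the matrix is invertible, and 0 otherwise. *)
Lemma kac_density_integral_le1 x :
  (iter_int leb (enum 'I_n) (kac_density x) (fun=> 0%R) <= 1)%E.
Proof.
pose f (y : 'I_n -> R) : \bar R := (\prod_(i <- enum 'I_n) phi (y i))%:E.
have mf : coord_measurable f.
  move=> d U g mg; apply/measurable_EFinP; apply: measurable_prod => i _.
  exact: measurable_phi.
have f0 y : (0 <= f y)%E.
  by rewrite lee_fin prodr_ge0// => i _; exact: normal_pdf_ge0.
have -> : kac_density x = fun u => (`|\det (mx_of_pairs x)|%:E * (f \o mulv (mx_of_pairs x)) u)%E.
  by apply/funext => u; rewrite /kac_density /f /= big_enum EFinM.
rewrite iter_int_mule//; last 2 first.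
- exact: coord_measurable_mulv.
- by move=> y /=.
have [->|d0] := eqVneq (\det (mx_of_pairs x)) 0.
  by rewrite normr0 mul0e.
rewrite linear_change ?unitmxE ?unitfE//.
rewrite (@iter_int_prod _ _ _ _ (fun=> phi) 1) ?enum_uniq//.
- by rewrite expr1n.
- by move=> i; exact: measurable_normal_pdf.
- by move=> i s; exact: normal_pdf_ge0.
- by move=> i; exact: integral_normal_pdf.
Qed.

(** Each row r of the matrix is weighted by exp (- r (1 + u^T u) r^T / 2). The
    whitening turns the quadratic form into |r|^2, and multiplies the
    determinant by (1 + |u|^2)^(-1/2). *)
Lemma kac_density_whitened x u :
  (kac_density (rowsact (whitening u) (enum 'I_n) x) u *
    (\prod_(p <- enum {: N2}) phi (rowsact (whitening u) (enum 'I_n) x p))%:E =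
   ((sqrt_1Dsqn u)^-1 * peak ^+ n)%:E *
   (`|\det (mx_of_pairs x)|%:E * (\prod_(p <- enum {: N2}) phi (x p))%:E))%E.
Proof.
move: (whitening u) (det_whitening u) (whiteningP u) => S detS SP.
have mS : mx_of_pairs (rowsact S (enum 'I_n) x) = mx_of_pairs x *m S.
  apply/matrixP => i j; rewrite [LHS]mxE [RHS]mxE /rowsact /= mem_enum.
  by apply: eq_bigr => k _; rewrite [mx_of_pairs x _ _]mxE.
rewrite /kac_density mS det_mulmx normrM detS.
have -> : `|(sqrt_1Dsqn u)^-1| = (sqrt_1Dsqn u)^-1.
  by rewrite ger0_norm// invr_ge0 ltW// sqrt_1Dsqn_gt0.
rewrite -!EFinM; congr (_%:E).
have pairE (h : N2 -> R) : \prod_p h p = \prod_i \prod_j h (i, j).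
  by rewrite pair_bigA; apply: eq_bigr => -[].
rewrite !big_enum/= (pairE (fun p => phi (rowsact S (enum 'I_n) x p))) (pairE (fun p => phi (x p))).
rewrite -mulrA -big_split/=.
rewrite (eq_bigr (fun i => peak * \prod_j phi (x (i, j)))) => [|i _].
  rewrite big_split/= prodr_const card_ord; ring.
pose r : 'rV[R]_n := row i (mx_of_pairs x).
have rowS j : rowsact S (enum 'I_n) x (i, j) = (r *m S) 0 j.
  rewrite /rowsact /= mem_enum mxE; apply: eq_bigr => k _.
  by rewrite !mxE.
under eq_bigr do rewrite rowS phiE.
under [in RHS]eq_bigr do rewrite phiE.
rewrite !big_split/= phiE !prodr_const card_ord -!expR_sum.
rewrite mulrACA -expRD mulrA; congr (_ * expR _); rewrite sumrN sumrN -opprD; congr (- _).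
rewrite -!mulr_suml -mulrDl; congr (_ * _).
have -> : mulv (mx_of_pairs x *m S) u i = (r *m S *m (rowu u)^T) 0 0.
  rewrite /r -row_mul mxE; apply: eq_bigr => k _.
  by rewrite !mxE.
have := congr1 (fun M : 'M[R]_n => (r *m M *m r^T) 0 0) SP.
rewrite mulmx1 mulmxDr mulmx1 mulmxDl mulmxDr mulmxDl mxE.
have -> : (r *m (S *m S^T) *m r^T) 0 0 = \sum_j (r *m S) 0 j ^+ 2.
  rewrite mulmxA -(mulmxA (r *m S)) -trmx_mul mxE; apply: eq_bigr => k _.
  by rewrite [(_^T) _ _]mxE expr2.
have -> : (r *m (S *m ((rowu u)^T *m rowu u) *m S^T) *m r^T) 0 0 =
    (r *m S *m (rowu u)^T) 0 0 ^+ 2.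
  rewrite !mulmxA -[_ *m rowu u *m _ *m _]mulmxA -[_ *m rowu u *m _]mulmxA.
  rewrite -trmx_mul (_ : rowu u *m (r *m S)^T = (r *m S *m (rowu u)^T)^T); last first.
    by rewrite [RHS]trmx_mul trmxK.
  by rewrite mxE big_ord1 [X in _ * X]mxE expr2.
rewrite addrC => ->; rewrite mxE; apply: eq_bigr => k _.
by rewrite !mxE expr2.
Qed.

(** The solution of a Gaussian linear system has a Cauchy distribution. With
    q = (1 + |u|^2)^(1/2), the whitening of the n rows has Jacobian q^-n, and the
    determinant of the matrix contributes one more factor q^-1. *)
Lemma kac_density_gaussian u :
  (iter_int gam (enum {: N2}) (kac_density^~ u) (fun=> 0%R) =
   (cauchy u)%:E * ((peak ^+ n)%:E * absdet_int))%E.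
Proof.
have uS : whitening u \in unitmx.
  by rewrite unitmxE det_whitening unitfE invr_eq0 gt_eqF// sqrt_1Dsqn_gt0.
have mk : coord_measurable (kac_density^~ u).
  by move=> d U g mg; apply: measurable_kac_density => // i; exact: measurable_cst.
have k0 x := kac_density_ge0 x u.
have mp : coord_measurable (fun x : N2 -> R => (\prod_(p <- enum {: N2}) phi (x p))%:E).
  move=> d U g mg; apply/measurable_EFinP; apply: measurable_prod => p _.
  exact: measurable_phi.
have p0 (x : N2 -> R) : (0 <= (\prod_(p <- enum {: N2}) phi (x p))%:E :> \bar R)%E.
  by rewrite lee_fin prodr_ge0// => p _; exact: normal_pdf_ge0.
rewrite iter_int_normal ?enum_uniq//.
rewrite -(linear_change_rows _ uS (enum_uniq 'I_n)); last 2 first.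
- by move=> d U g mg; apply: emeasurable_funM; [exact: mk|exact: mp].
- by move=> x; rewrite mule_ge0.
rewrite [X in (_ * X)%E](_ : _ = (((sqrt_1Dsqn u)^-1 * peak ^+ n)%:E * absdet_int)%E); last first.
  rewrite /absdet_int iter_int_normal ?enum_uniq//; last exact: coord_measurable_absdet.
  rewrite -iter_int_mule//; last 3 first.
  - rewrite lee_fin mulr_ge0 ?exprn_ge0 ?normal_peak_ge0//.
    by rewrite invr_ge0 ltW// sqrt_1Dsqn_gt0.
  - by move=> d U g mg; apply: emeasurable_funM; [exact: coord_measurable_absdet|exact: mp].
  - by move=> x; rewrite mule_ge0// lee_fin.
  congr (iter_int _ _ _ _); apply/funext => x /=; exact: kac_density_whitened.
rewrite !muleA -!EFinM; congr (_%:E * _)%E.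
rewrite det_whitening ger0_norm ?invr_ge0 ?ltW ?sqrt_1Dsqn_gt0// size_enum_ord.
rewrite mulrA -exprSr; congr (_ * _).
rewrite /cauchy powRN exprVn; congr (_^-1).
rewrite /sqrt_1Dsqn -powR12_sqrt ?addr_ge0 ?sqn_ge0//.
by rewrite -powR_mulrn ?powR_ge0// -powRrM mulrC.
Qed.

(** Integrate [kac_density] over matrices and over [u]. Over [u] first, the
    total is at most 1; over matrices first, it is the left-hand side times the
    integral of the Cauchy density. *)
Lemma absdet_int_le :
  ((peak ^+ n)%:E * absdet_int <= ((vol_proj R n)^-1)%:E)%E.
Proof.
have [v0 cE] := cauchy_intE (R := R) n.
have : (iter_int gam (enum {: N2}) (fun x => iter_int leb (enum 'I_n) (kac_density x) (fun=> 0%R)) (fun=> 0%R) <= 1)%E.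
  apply: (@le_trans _ _ (iter_int gam (enum {: N2}) (fun=> 1%E) (fun=> 0%R))).
    apply: le_iter_int.
    - move=> d U g mg.
      apply: (param_measurable_iter_int leb (enum 'I_n) (f := fun a => kac_density (g a)) _ _ (h := id) (g := fun _ _ => 0%R)) => //.
      + by move=> d' U' h' g' mh' mg'; apply: measurable_kac_density => // p; exact: (measurableT_comp (mg p)).
      + by move=> a u; exact: kac_density_ge0.
    - by move=> d U g mg; exact: measurable_cst.
    - by move=> x; apply: iter_int_ge0 => u; exact: kac_density_ge0.
    - exact: kac_density_integral_le1.
  have := @iter_int_prod R _ gam (enum {: N2}) (fun=> cst 1) 1 (fun=> 0) (enum_uniq _).
  have -> : (fun y : N2 -> R => (\prod_(i <- enum {: N2}) (cst 1 (y i) : R))%:E) = fun=> 1%E.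
    by apply/funext => y; rewrite big1.
  rewrite expr1n => -> // _.
  have := @integral_cst _ _ _ gam setT measurableT 1%E.
  by rewrite mul1e => h; apply: (etrans h); exact: (@probability_setT _ _ _ gam).
rewrite iter_int_swap; last 2 first.
- by move=> *; exact: measurable_kac_density.
- by move=> x u; exact: kac_density_ge0.
under eq_iter_int do rewrite kac_density_gaussian muleC.
have a0 : (0 <= (peak ^+ n)%:E * absdet_int)%E.
  rewrite mule_ge0 ?lee_fin ?exprn_ge0 ?normal_peak_ge0//.
  by apply: iter_int_ge0 => x; rewrite lee_fin.
rewrite iter_int_mule//; last 2 first.
- move=> d U g mg; apply/measurable_EFinP; apply: measurable_powR_comp.
  by apply: measurable_funD => //; exact: measurable_sqn.
- by move=> u; rewrite lee_fin powR_ge0.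
rewrite -/(cauchy_int n) cE => h.
have v1 : ((vol_proj R n)%:E * (vol_proj R n)^-1%:E = 1 :> \bar R)%E.
  by rewrite -EFinM divff// gt_eqF.
rewrite -[leLHS]mule1 -[X in (_ * X <= _)%E]v1 muleA -[leRHS]mul1e.
apply: lee_wpmul2r; last exact: h.
by rewrite lee_fin invr_ge0 ltW.
Qed.

End gaussian_determinant.

(** * Integrating out independent Gaussian variables *)

Section independence.
Context {R : realType} d (T : measurableType d) (P : probability T R).
Local Notation gam := (@normal_prob R 0 1).
Variables (J : finType) (X : J -> {RV P >-> R}).
Hypothesis X_gaussian : forall j, standard_gaussian (X j).
Hypothesis X_indep : mutually_independent X.

(** A pi-system generating the events that involve the variables other than [X i]. *)
Definition cylinders_off (i : J) : set (set T) :=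
  [set A | exists2 B : J -> set R, (forall j, measurable (B j)) &
           A = \bigcap_(j in [set` [set~ i]%SET]) (X j @^-1` B j)].

Lemma measurable_preX j (B : set R) : measurable B -> measurable (X j @^-1` B).
Proof. by move=> mB; rewrite -[_ @^-1` _]setTI; exact: (measurable_funP (X j)). Qed.

Lemma cylinders_off_setI i : setI_closed (cylinders_off i).
Proof.
move=> _ _ [B mB ->] [C mC ->]; exists (fun j => B j `&` C j).
  by move=> j; exact: measurableI.
by rewrite -bigcapI; apply: eq_bigcapr => j _; rewrite preimage_setI.
Qed.

Lemma cylinders_off_measurable i A : <<s cylinders_off i >> A -> measurable A.
Proof.
apply: smallest_sub; first exact: sigma_algebra_measurable.
move=> _ [B mB ->]; apply: fin_bigcap_measurable => // j _.
exact: measurable_preX.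
Qed.

(** The sets [A] with this property form a Dynkin system, and on cylinders it is
    mutual independence. *)
Lemma cylinders_off_indep i A (B : set R) : <<s cylinders_off i >> A -> measurable B ->
  P (A `&` X i @^-1` B) = (P A * gam B)%E.
Proof.
move=> + mB; move: A.
have mE := measurable_preX i mB.
have PE : P (X i @^-1` B) = gam B by rewrite -(X_gaussian i mB).
apply: (@dynkin_induction _ (g_sigma_algebraType (cylinders_off i)) (cylinders_off i)
  (fun A => P (A `&` X i @^-1` B) = (P A * gam B)%E)) => //.
- exact: cylinders_off_setI.
- by rewrite setTI probability_setT mul1e.
- move=> _ [C mC ->].
  pose C' j := if j == i then B else C j.
  have mC' j : measurable (C' j) by rewrite /C'; case: ifP.
  have := X_indep (J := [set: J]%SET) (B := C') (fun j _ => mC' j).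
  rewrite (bigD1 i) ?finset.in_setT//=.
  rewrite {2}/C' eqxx PE => h.
  have hC := X_indep (J := [set~ i]%SET) (B := C) (fun j _ => mC j).
  transitivity ((\prod_(j in [set~ i]%SET) P (X j @^-1` C j)) * gam B)%E; last first.
    by congr (_ * _)%E; exact/esym/hC.
  transitivity (P (\bigcap_(i in [set` [set: J]%SET]) (X i @^-1` C' i))).
    congr (P _); apply/seteqP; split => [w [hw Bw] j _|w hw].
      rewrite /C'; case: eqVneq => [->//|ji]; apply: hw => /=.
      by rewrite !inE.
    split; last by have := hw i; rewrite /C' eqxx; apply; rewrite /= finset.in_setT.
    move=> j /=; rewrite !inE => ji; have := hw j.
    by rewrite /C' (negbTE ji); apply; rewrite /= finset.in_setT.
  rewrite h muleC; congr (_ * _)%E.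
  apply: eq_big => j; first by rewrite !inE.
  by rewrite /C' => /andP[_ /negbTE ->].
- move=> S mS PS.
  have mS' := cylinders_off_measurable mS.
  rewrite probability_setC// muleBl ?fin_num_measure// -PS mul1e -PE.
  have -> : ~` S `&` X i @^-1` B = X i @^-1` B `\` S by rewrite setDE setIC.
  have := measureDI P mE mS'; rewrite [_ `&` S]setIC => ->.
  by rewrite addeK// fin_num_measure//; exact: measurableI.
- move=> F mF tF PF.
  have mF' k := cylinders_off_measurable (mF k).
  rewrite setI_bigcupl !measure_bigcup//; last 2 first.
  + by move=> k _; exact: measurableI.
  + exact: trivIset_setIr.
  rewrite muleC -(fineK (fin_num_measure gam _ mB)) -nneseriesZl//.
  by apply: eq_eseriesr => k _; rewrite (fineK (fin_num_measure gam _ mB)) muleC; exact: PF.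
Qed.

(** The joint law of [X i] and of the other variables is a product measure, so
    Tonelli applies. The other variables are represented by the sample space
    itself, with the sigma-algebra that they generate. *)
Lemma integral_replace (i : J) (f : (J -> R) -> \bar R) :
  coord_measurable f -> (forall x, 0 <= f x)%E ->
  (\int[P]_w f (X^~ w) = \int[P]_w coord_int gam i f (X^~ w))%E.
Proof.
move=> mf f0.
pose T' := g_sigma_algebraType (cylinders_off i).
pose Y : T -> T' := id.
have mY : measurable_fun setT Y.
  by move=> _ A mA; rewrite setTI; exact: cylinders_off_measurable mA.
pose Ym : {mfun T >-> T'} := HB.pack Y (isMeasurableFun.Build _ _ _ _ _ mY).
pose Z : T -> (T' * measurableTypeR R)%type := fun w => (w, X i w).
have mZ : measurable_fun setT Z.
  by apply: measurable_fun_pair => //; exact: (measurable_funP (X i)).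
pose Zm : {mfun T >-> (T' * measurableTypeR R)%type} := HB.pack Z (isMeasurableFun.Build _ _ _ _ _ mZ).
pose x (w : T') : J -> R := X^~ w.
pose F (p : T' * measurableTypeR R) : \bar R := f (update (x p.1) i p.2).
have mXj j : j != i -> measurable_fun [set: T'] (X j : T' -> R).
  move=> ji _ A mA; rewrite setTI; apply: sub_gen_smallest.
  exists (fun k => if k == j then A else setT); first by move=> k; case: ifP.
  apply/seteqP; split => [w Aw k _ /=|w hw]; first by case: eqVneq => [->//|].
  have := hw j; rewrite /= eqxx; apply.
  by rewrite /= !inE.
have mF : measurable_fun setT F.
  apply: mf => j; rewrite /update; case: eqVneq => [_|ji]; first exact: measurable_snd.
  by apply: (measurableT_comp (mXj j ji)); exact: measurable_fst.
transitivity (\int[P]_w F (Z w))%E.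
  apply: eq_integral => w _; rewrite /F /Z /=; congr f; apply/funext => j.
  by rewrite /update; case: eqVneq => [->|].
rewrite -(@ge0_integral_distribution _ _ _ _ _ P Zm F)//; last by move=> p; exact: f0.
transitivity (\int[(distribution P Ym : probability _ _) \x gam]_p F p)%E.
  apply: eq_measure_integral => /= A mA _; apply/esym.
  apply: product_measure_unique => //= B C mB mC.
  exact: cylinders_off_indep mB mC.
rewrite fubini_tonelli1//; last by move=> p; exact: f0.
rewrite (@ge0_integral_distribution _ _ _ _ _ P Ym)//.
- by apply: (@measurable_fun_fubini_tonelli_F _ _ T' _ R gam F) => // p; exact: f0.
- by move=> w; apply: integral_ge0 => s _; exact: f0.
Qed.

Lemma integral_replaces (l : seq J) (f : (J -> R) -> \bar R) :
  coord_measurable f -> (forall x, 0 <= f x)%E ->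
  (\int[P]_w f (X^~ w) = \int[P]_w iter_int gam l f (X^~ w))%E.
Proof.
move=> mf f0; elim: l => //= i l ->; apply: integral_replace.
  exact: coord_measurable_iter_int.
by move=> x; exact: iter_int_ge0.
Qed.

End independence.

(** * The Cauchy-Binet formula *)

Section cauchy_binet.
Variables (R : numDomainType) (n : nat) (K : finType).
Variables (C : 'I_n -> K -> R) (D : K -> 'I_n -> R).
Implicit Types g : {ffun 'I_n -> K}.

Definition colsel g : 'M[R]_n := \matrix_(i, j) C i (g j).
Definition rowsel g : 'M[R]_n := \matrix_(i, j) D (g i) j.
Definition prodmx : 'M[R]_n := \matrix_(i, j) \sum_k C i k * D k j.

Lemma det_prodmx : \det prodmx = \sum_(g : {ffun 'I_n -> K}) (\prod_i C i (g i)) * \det (rowsel g).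
Proof.
rewrite /determinant.
under eq_bigr => s _.
  under eq_bigr do rewrite mxE.
  rewrite bigA_distr_bigA/=.
  under eq_bigr do rewrite big_split/=.
  rewrite mulr_sumr; over.
rewrite exchange_big/=; apply: eq_bigr => g _.
rewrite mulr_sumr; apply: eq_bigr => s _.
rewrite mulrCA; congr (_ * (_ * _)).
by apply: eq_bigr => i _; rewrite mxE.
Qed.

(** Summing over maps instead of subsets replaces a choice of [n] columns by all
    its orderings, whence the factorial. *)
Lemma cauchy_binet : n`!%:R * \det prodmx = \sum_(g : {ffun 'I_n -> K}) \det (colsel g) * \det (rowsel g).
Proof.
under [RHS]eq_bigr do rewrite {1}/determinant mulr_suml.
rewrite exchange_big/= (eq_bigr (fun=> \det prodmx)) => [|s _].
  by rewrite sumr_const card_Sn mulr_natl.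
(* every permutation s of the expansion of the first minor contributes the
   same, since g can be replaced by its composite with s *)
rewrite det_prodmx.
pose h (g : {ffun 'I_n -> K}) : {ffun 'I_n -> K} := [ffun i => g (s i)].
pose h' (g : {ffun 'I_n -> K}) : {ffun 'I_n -> K} := [ffun i => g ((s^-1)%g i)].
rewrite [RHS](reindex h)/=; last first.
  exists h' => g _; apply/ffunP => i; rewrite !ffunE ?permKV ?permK//.
apply: eq_bigr => g _.
have -> : rowsel (h g) = row_perm s (rowsel g).
  by apply/matrixP => i j; rewrite !mxE ffunE.
rewrite row_permE det_mulmx det_perm.
under eq_bigr do rewrite mxE.
under [in RHS]eq_bigr do rewrite ffunE.
by rewrite mulrCA mulrA.
Qed.

(** Maps that repeat an index, or that take the value [v] where [D] has a zero
    row, have a vanishing minor. *)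
Lemma norm_det_prodmx_le v : (forall j, D v j = 0) ->
  n`!%:R * `|\det prodmx| <=
  \sum_(g in [set g in ffun_on (predC1 v) | injectiveb g]%SET)
    `|\det (colsel g)| * `|\det (rowsel g)|.
Proof.
move=> Dv; rewrite -[X in X * _]normr_nat -normrM cauchy_binet.
rewrite (bigID [in [set g : {ffun 'I_n -> K} in ffun_on (predC1 v) | injectiveb g]%SET])/=.
rewrite [X in _ + X]big1 ?addr0 => [|g].
  apply: le_trans (ler_norm_sum _ _ _) _.
  by apply: ler_sum => g _; rewrite normrM.
rewrite !inE negb_and => /orP[|].
  move=> /forallPn[i]; rewrite !inE negbK => /eqP gi.
  rewrite (expand_det_row (rowsel g) i) big1 ?mulr0// => j _.
  by rewrite mxE gi Dv mul0r.
move=> /injectivePn[i [j ij gij]].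
suff -> : \det (rowsel g) = 0 by rewrite mulr0.
by apply: (determinant_alternate ij) => k; rewrite !mxE gij.
Qed.

Lemma card_injections_avoiding v :
  #|[set g : {ffun 'I_n -> K} in ffun_on (predC1 v) | injectiveb g]%SET| =
  ('C(#|K|.-1, n) * n`!)%N.
Proof.
rewrite bin_ffact -[n in RHS]card_ord -(cardC1 v).
by rewrite -card_inj_ffuns_on.
Qed.

End cauchy_binet.

(** * Newton's method near a nondegenerate zero of exponential sums *)

Section exponential_sums.
Context {R : realType}.
Variables (n : nat) (K : finType) (beta : K -> 'rV[R]_n).
Implicit Types (w x y z : 'rV[R]_n) (g : K -> R).

Lemma rV_norm_le m (x : 'rV[R]_m) e : 0 <= e -> (forall j, `|x 0 j| <= e) -> `|x| <= e.
Proof.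
move=> e0 h; rewrite [leLHS]/Num.Def.normr/= mx_normrE (bigmax_le _ e0)//= => -[i j] _ /=.
by rewrite ord1.
Qed.

Lemma rV_coord_le m (x : 'rV[R]_m) j : `|x 0 j| <= `|x|.
Proof.
by rewrite [leRHS]/Num.Def.normr/= mx_normrE; exact: (le_bigmax _ _ (0, j)).
Qed.

(** Follows from exp h >= 1 + h, for h and for -h. *)
Lemma expR_taylor2 (h : R) : `|h| <= 2^-1 -> `|expR h - 1 - h| <= 2 * h ^+ 2.
Proof.
move=> hh; have [h1 h2] : - 2^-1 <= h /\ h <= 2^-1.
  by move: hh; rewrite ler_norml => /andP.
have lo := expR_ge1Dx h.
have lo' := expR_ge1Dx (- h).
rewrite ger0_norm; last by lra.
have e0 : 0 < expR h by exact: expR_gt0.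
have : expR h * (1 - h) <= 1.
  by rewrite -[leRHS](expRxMexpNx_1 h) ler_pM2l.
have : 0 <= h ^+ 2 by exact: sqr_ge0.
nra.
Qed.

(** The frequencies form an arbitrary finite family, so that they can be
    translated by a vertex. *)
Definition expsum g w : R := \sum_k g k * expR (dotp (beta k) w).
Definition dexpsum g w j : R := \sum_k g k * (beta k 0 j * expR (dotp (beta k) w)).

Lemma dotpB (u : 'rV[R]_n) x y : dotp u (x - y) = dotp u x - dotp u y.
Proof. by rewrite /dotp -sumrB; apply: eq_bigr => j _; rewrite !mxE mulrBr. Qed.

Definition freq_bound : R := \sum_k \sum_j `|beta k 0 j|.
Local Notation B := freq_bound.

Lemma freq_bound_ge0 : 0 <= B.
Proof. by apply: sumr_ge0 => k _; apply: sumr_ge0. Qed.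

Lemma norm_dotp_le k h : `|dotp (beta k) h| <= B * `|h|.
Proof.
apply: le_trans (ler_norm_sum _ _ _) _.
apply: (@le_trans _ _ (\sum_j `|beta k 0 j| * `|h|)).
  by apply: ler_sum => j _; rewrite normrM ler_wpM2l// rV_coord_le.
rewrite -mulr_suml ler_wpM2r// /B (bigD1 k)//= lerDl.
by apply: sumr_ge0 => i _; apply: sumr_ge0.
Qed.

(** With exp <b, x> factored out of each term, there remains the Taylor
    remainder of exp at <b, y - x>. *)
Lemma expsum_taylor g z : exists C rho, [/\ 0 <= C, 0 < rho &
  forall x y, `|x - z| <= rho -> `|y - z| <= rho ->
    `|expsum g y - expsum g x - \sum_j dexpsum g x j * (y - x) 0 j| <= C * `|y - x| ^+ 2].
Proof.
have B0 := freq_bound_ge0.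
pose rho := (4 * (B + 1))^-1.
have rho0 : 0 < rho by rewrite invr_gt0 mulr_gt0// ltr_wpDl.
have Brho : B * rho <= 4^-1.
  by rewrite /rho ler_pdivrMr ?mulr_gt0 ?ltr_wpDl// mulrA mulVf// mul1r lerDl.
pose C := \sum_k `|g k| * expR (dotp (beta k) z + 1) * (2 * B ^+ 2).
have C0 : 0 <= C.
  by apply: sumr_ge0 => k _; rewrite !mulr_ge0// ?expR_ge0// sqr_ge0.
exists C, rho; split => // x y xz yz.
have -> : expsum g y - expsum g x - \sum_j dexpsum g x j * (y - x) 0 j =
    \sum_k g k * expR (dotp (beta k) x) *
      (expR (dotp (beta k) (y - x)) - 1 - dotp (beta k) (y - x)).
  have -> : \sum_j dexpsum g x j * (y - x) 0 j =
      \sum_k g k * expR (dotp (beta k) x) * dotp (beta k) (y - x).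
    under eq_bigr do rewrite /dexpsum mulr_suml.
    rewrite exchange_big/=; apply: eq_bigr => k _.
    rewrite /dotp mulr_sumr; apply: eq_bigr => j _; ring.
  rewrite /expsum -!sumrB; apply: eq_bigr => k _.
  have -> : expR (dotp (beta k) y) = expR (dotp (beta k) x) * expR (dotp (beta k) (y - x)).
    by rewrite -expRD dotpB addrC subrK.
  by ring.
apply: le_trans (ler_norm_sum _ _ _) _; rewrite /C mulr_suml.
apply: ler_sum => k _; rewrite normrM normrM -mulrA -mulrA -[leRHS]mulrA.
apply: ler_wpM2l => //.
have yx : `|y - x| <= 2 * rho.
  rewrite -(subrKA z) mulr2n mulrDl mul1r (le_trans (ler_normD _ _))// lerD//.
  by rewrite distrC.
have dyx : `|dotp (beta k) (y - x)| <= 2^-1.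
  apply: le_trans (norm_dotp_le k (y - x)) _.
  apply: (@le_trans _ _ (B * (2 * rho))); first by rewrite ler_wpM2l.
  by lra.
rewrite ger0_norm ?expR_ge0// -[leRHS]mulrA; apply: ler_pM => //.
- rewrite ler_expR -[dotp _ x](subrK (dotp (beta k) z)) -dotpB addrC lerD2l.
  apply: le_trans (ler_norm _) _; apply: le_trans (norm_dotp_le k (x - z)) _.
  by apply: (@le_trans _ _ (B * rho)); [rewrite ler_wpM2l|lra].
- apply: le_trans (expR_taylor2 dyx) _; rewrite -mulrA ler_wpM2l// -exprMn.
  rewrite -[leLHS]real_normK ?num_real// lerXn2r ?nnegrE ?mulr_ge0//.
  exact: norm_dotp_le.
Qed.

Variable G : 'I_n -> K -> R.

Lemma expsums_taylor z : exists C rho, [/\ 0 <= C, 0 < rho &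
  forall i x y, `|x - z| <= rho -> `|y - z| <= rho ->
    `|expsum (G i) y - expsum (G i) x - \sum_j dexpsum (G i) x j * (y - x) 0 j|
      <= C * `|y - x| ^+ 2].
Proof.
have /choice[Cr Crp] : forall i, exists Cr : R * R, [/\ 0 <= Cr.1, 0 < Cr.2 &
    forall x y, `|x - z| <= Cr.2 -> `|y - z| <= Cr.2 ->
    `|expsum (G i) y - expsum (G i) x - \sum_j dexpsum (G i) x j * (y - x) 0 j|
      <= Cr.1 * `|y - x| ^+ 2].
  by move=> i; have [C [r h]] := expsum_taylor (G i) z; exists (C, r).
exists (\sum_i (Cr i).1), (\big[Num.min/1]_i (Cr i).2); split.
- by apply: sumr_ge0 => i _; have [] := Crp i.
- by apply: lt_bigmin => // i _; have [] := Crp i.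
move=> i x y xz yz; have [_ _ h] := Crp i.
have ri : \big[Num.min/1]_i (Cr i).2 <= (Cr i).2 by exact: bigmin_le_cond.
apply: le_trans (h x y (le_trans xz ri) (le_trans yz ri)) _.
rewrite ler_wpM2r ?sqr_ge0// (bigD1 i)//= lerDl.
by apply: sumr_ge0 => k _; have [] := Crp k.
Qed.

Definition dexpsum_mx w : 'M[R]_n := \matrix_(i, j) dexpsum (G i) w j.

Lemma continuous_sumR (T : topologicalType) (I : Type) (r : seq I) (F : I -> T -> R) :
  (forall i, continuous (F i)) -> continuous (fun t => \sum_(i <- r) F i t : R).
Proof.
move=> cF; elim: r => [|i r ih].
  rewrite (_ : (fun t => _) = cst 0); first exact: cst_continuous.
  by apply/funext => t; rewrite big_nil.
rewrite (_ : (fun t => _) = fun t => F i t + \sum_(i <- r) F i t).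
  by move=> t; apply: (@cvgD _ R^o) => //; [exact: cF|exact: ih].
by apply/funext => t; rewrite big_cons.
Qed.

Lemma continuous_prodR (T : topologicalType) (I : Type) (r : seq I) (F : I -> T -> R) :
  (forall i, continuous (F i)) -> continuous (fun t => \prod_(i <- r) F i t : R).
Proof.
move=> cF; elim: r => [|i r ih].
  rewrite (_ : (fun t => _) = cst 1); first exact: cst_continuous.
  by apply/funext => t; rewrite big_nil.
rewrite (_ : (fun t => _) = fun t => F i t * \prod_(i <- r) F i t).
  by move=> t; apply: cvgM => //; [exact: cF|exact: ih].
by apply/funext => t; rewrite big_cons.
Qed.

Lemma continuous_cstM (T : topologicalType) (c : R) (f : T -> R) :
  continuous f -> continuous (fun t => c * f t : R).
Proof. by move=> cf t; exact: (cvgM (cvg_cst c) (cf t)). Qed.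

Lemma continuous_dotp (u : 'rV[R]_n) : continuous (fun w : 'rV[R]_n => dotp u w : R).
Proof.
by apply: continuous_sumR => j; apply: continuous_cstM; exact: coord_continuous.
Qed.

Lemma continuous_dexpsum g j : continuous (fun w : 'rV[R]_n => dexpsum g w j : R).
Proof.
apply: continuous_sumR => k; do 2 apply: continuous_cstM.
move=> w; apply: (@continuous_comp _ _ _ (fun w : 'rV[R]_n => dotp (beta k) w : R) expR).
  exact: continuous_dotp.
exact: continuous_expR.
Qed.

Lemma continuous_det m (T : topologicalType) (M : T -> 'M[R]_m) :
  (forall i j, continuous (fun t => M t i j : R)) -> continuous (fun t => \det (M t) : R).
Proof.
move=> cM; apply: continuous_sumR => s; apply: continuous_cstM.
by apply: continuous_prodR => i; exact: cM.
Qed.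

Lemma continuous_adj m (T : topologicalType) (M : T -> 'M[R]_m) i j :
  (forall i j, continuous (fun t => M t i j : R)) -> continuous (fun t => (\adj (M t)) i j : R).
Proof.
move=> cM; under [X in continuous X]eq_fun do rewrite mxE /cofactor.
apply: continuous_cstM.
apply: continuous_det => a b; under [X in continuous X]eq_fun do rewrite !mxE.
exact: cM.
Qed.

Lemma near_closed_ball (z : 'rV[R]_n) (Q : 'rV[R]_n -> Prop) :
  (\forall w \near z, Q w) -> exists2 rho, 0 < rho & forall w, `|w - z| <= rho -> Q w.
Proof.
move=> /nbhs_normP[r /= r0 rQ]; exists (r / 2); first by rewrite divr_gt0.
move=> w wz; apply: rQ => /=; rewrite distrC (le_lt_trans wz)//.
by rewrite ltr_pdivrMr// ltr_pMr// ltr1n.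
Qed.

Lemma continuous_near_dist (f : 'rV[R]_n -> R) z e : continuous f -> 0 < e ->
  \forall w \near z, `|f z - f w| < e.
Proof. by move=> cf e0; move: (cf z) => /cvgrPdist_lt/(_ e e0). Qed.

Definition expsum_col w : 'cV[R]_n := \col_i expsum (G i) w.

(** With D the Jacobian matrix at [w], Taylor's formula reads
    F(w) = D (w - z) - r with r of order eps^2, hence
    adj D F(w) = det D (w - z) - adj D r. Near [z] the adjugate is bounded and
    |det D| is bounded below. *)
Lemma newton_step_small z (eta : R) : 0 < eta -> (forall i, expsum (G i) z = 0) ->
  \det (dexpsum_mx z) != 0 ->
  exists2 rho, 0 < rho & forall eps w, 0 < eps -> eps <= rho -> `|w - z| <= eps ->
    \det (dexpsum_mx w) != 0 /\
    forall j, `|(\adj (dexpsum_mx w) *m expsum_col w) j 0| <=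
              (1 + eta) * eps * `|\det (dexpsum_mx w)|.
Proof.
move=> eta0 Gz dz.
have cD i j : continuous (fun w => dexpsum_mx w i j : R).
  rewrite (_ : (fun w => _) = fun w => dexpsum (G i) w j); first exact: continuous_dexpsum.
  by apply/funext => w; rewrite mxE.
pose dt : R := `|\det (dexpsum_mx z)|.
have dt0 : 0 < dt / 2 by rewrite divr_gt0// normr_gt0.
pose L : R := \sum_i \sum_j (`|\adj (dexpsum_mx z) i j| + 1).
have Lij i j : `|\adj (dexpsum_mx z) i j| + 1 <= L.
  rewrite /L (bigD1 i)//= (bigD1 j)//= -addrA lerDl addr_ge0//.
    by apply: sumr_ge0.
  by apply: sumr_ge0 => k _; apply: sumr_ge0 => l _; rewrite addr_ge0.
have L0 : 0 <= L by apply: sumr_ge0 => i _; apply: sumr_ge0 => j _; rewrite addr_ge0.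
have [r1 r10 near1] : exists2 rho, 0 < rho & forall w, `|w - z| <= rho ->
    dt / 2 <= `|\det (dexpsum_mx w)| /\
    forall ij : 'I_n * 'I_n, `|\adj (dexpsum_mx w) ij.1 ij.2| <= L.
  apply: near_closed_ball.
  have na : \forall w \near z, forall ij : 'I_n * 'I_n, `|\adj (dexpsum_mx w) ij.1 ij.2| <= L.
    apply: (@filter_forall _ _ (fun (ij : 'I_n * 'I_n) w => `|\adj (dexpsum_mx w) ij.1 ij.2| <= L) _ (nbhs_filter z)) => -[i j] /=.
    move: (continuous_near_dist z (continuous_adj (i := i) (j := j) cD) ltr01); apply: filterS => w h.
    apply: le_trans (Lij i j); rewrite -lerBlDl.
    by apply: le_trans (lerB_dist _ _) _; rewrite distrC ltW.
  have nd : \forall w \near z, dt / 2 <= `|\det (dexpsum_mx w)|.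
    move: (continuous_near_dist z (continuous_det cD) dt0); apply: filterS => w h.
    have := lerB_dist (\det (dexpsum_mx z)) (\det (dexpsum_mx w)).
    by rewrite -/dt => h'; lra.
  by move: nd na; apply: filterS2 => w; split.
have [C [r2 [C0 r20 taylor]]] := expsums_taylor z.
(* below this radius the remainder term is at most eta eps |det D| *)
pose r3 := eta * (dt / 2) / (n%:R * L * C + 1).
have nLC0 : 0 <= n%:R * L * C by rewrite !mulr_ge0.
have r30 : 0 < r3.
  by apply: divr_gt0; [exact: mulr_gt0|exact: ltr_wpDl].
have nLCr3 : n%:R * L * C * r3 <= eta * (dt / 2).
  have N1 : 0 < n%:R * L * C + 1 by exact: ltr_wpDl.
  have X1 : n%:R * L * C / (n%:R * L * C + 1) <= 1.
    by rewrite ler_pdivrMr// mul1r lerDl ler01.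
  have Y0 : 0 <= eta * (dt / 2) by rewrite mulr_ge0// ltW.
  by rewrite /r3 mulrCA -[leRHS]mulr1 ler_wpM2l.
exists (Num.min r1 (Num.min r2 r3)); first by rewrite !lt_min r10 r20 r30.
move=> eps w e0; rewrite !le_min => /and3P[er1 er2 er3] wz.
have [det_ge adj_le] := near1 w (le_trans wz er1).
split; first by rewrite -normr_gt0 (lt_le_trans dt0).
move=> j.
pose r : 'cV[R]_n := \col_i (expsum (G i) z - expsum (G i) w - \sum_k dexpsum (G i) w k * (z - w) 0 k).
have -> : expsum_col w = dexpsum_mx w *m (w - z)^T - r.
  apply/colP => i; rewrite !mxE Gz sub0r !opprD !opprK addrCA.
  rewrite -[LHS]addr0; congr (_ + _); rewrite -big_split/= big1// => k _.
  by rewrite !mxE; ring.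
rewrite mulmxBr mulmxA mul_adj_mx mul_scalar_mx.
have rle i : `|r i 0| <= C * eps ^+ 2.
  rewrite mxE; apply: le_trans (taylor i w z _ _) _.
  - exact: le_trans wz er2.
  - by rewrite subrr normr0 ltW.
  by rewrite ler_wpM2l// lerXn2r ?nnegrE// ?(ltW e0)// distrC.
rewrite !mxE; apply: le_trans (ler_normB _ _) _.
rewrite mulrDl mul1r mulrDl; apply: lerD.
  rewrite normrM mulrC ler_wpM2r//.
  by have := rV_coord_le (w - z) j; rewrite !mxE => /le_trans; apply.
apply: le_trans (ler_norm_sum _ _ _) _.
apply: (@le_trans _ _ (\sum_(k < n) L * (C * eps ^+ 2))).
  by apply: ler_sum => k _; rewrite normrM; apply: ler_pM => //; exact: (adj_le (j, k)).
rewrite sumr_const card_ord -mulr_natl.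
have h1 : n%:R * L * C * eps <= eta * (dt / 2).
  by apply: le_trans nLCr3; rewrite ler_wpM2l.
apply: (@le_trans _ _ (eta * (dt / 2) * eps)).
  rewrite (_ : _ * _ = n%:R * L * C * eps * eps); last by ring.
  by rewrite ler_wpM2r// ltW.
by rewrite mulrAC; apply: ler_wpM2l; rewrite // mulr_ge0// ltW.
Qed.

Lemma norm_mulmx_le (M : 'M[R]_n) (h : 'rV[R]_n) :
  `|h *m M| <= (\sum_i \sum_j `|M i j|) * `|h|.
Proof.
have S0 (I : finType) (f : I -> R) : (forall i, 0 <= f i) -> 0 <= \sum_i f i.
  by move=> f0; exact: sumr_ge0.
apply: rV_norm_le => [|j]; first by rewrite mulr_ge0// S0// => i; exact: S0.
rewrite mxE mulr_suml; apply: le_trans (ler_norm_sum _ _ _) _.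
apply: ler_sum => i _; rewrite normrM mulrC; apply: ler_pM => //.
  by rewrite (bigD1 j)//= lerDl sumr_ge0.
exact: rV_coord_le.
Qed.

Lemma continuous_mulmxr (M : 'M[R]_n) : continuous (mulmxr M : 'rV[R]_n -> 'rV[R]_n).
Proof.
move=> x; apply/(@cvgrPdist_le R 'rV[R]_n _ _ (nbhs_filter x)) => /= e e0.
pose B : R := \sum_i \sum_j `|M i j|.
have B0 : 0 <= B by apply: sumr_ge0 => i _; exact: sumr_ge0.
have B1 : 0 < B + 1 by exact: ltr_wpDl.
apply/(@nbhs_normP R 'rV[R]_n x); exists (e / (B + 1)); first exact: divr_gt0.
move=> y /= xy; rewrite -mulmxBl (le_trans (norm_mulmx_le _ _))// -/B.
move: xy; rewrite ltr_pdivlMr// mulrC => /ltW/(le_trans _); apply.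
by rewrite ler_wpM2r// lerDl.
Qed.

(** By uniqueness of the differential, from the quadratic Taylor bound. *)
Lemma jacobian_expsum z :
  'J (fun w => \row_i expsum (G i) w : 'rV[R]_n) z = (dexpsum_mx z)^T.
Proof.
set F := fun w => _.
suff dF : 'd F z = mulmxr (dexpsum_mx z)^T :> ('rV[R]_n -> 'rV[R]_n).
  by apply/row_matrixP => i; rewrite !rowE /jacobian mul_rV_lin1 dF.
apply: diff_unique; first exact: continuous_mulmxr.
apply/eqaddoP => e e0.
have [C [r [C0 r0 taylor]]] := expsums_taylor z.
have C1 : 0 < C + 1 by exact: ltr_wpDl.
apply/(@nbhs_normP R 'rV[R]_n 0); exists (Num.min r (e / (C + 1))).
  by rewrite /= lt_min r0 divr_gt0.
move=> h /=; rewrite sub0r normrN lt_min => /andP[hr hC].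
apply: rV_norm_le => [|i]; first by rewrite mulr_ge0// ltW.
have := taylor i z (h + z).
rewrite subrr normr0 addrK => /(_ (ltW r0) (ltW hr)) /le_trans H.
have {}hC : C * `|h| <= e.
  move: hC; rewrite ltr_pdivlMr// mulrC => /ltW/(le_trans _); apply.
  by rewrite ler_wpM2r// lerDl.
rewrite (_ : _ 0 i = expsum (G i) (h + z) - expsum (G i) z - \sum_j dexpsum (G i) z j * h 0 j).
  by apply: H; rewrite expr2 mulrA ler_wpM2r.
rewrite !mxE opprD addrA; congr (_ - _); apply: eq_bigr => j _.
by rewrite !mxE mulrC.
Qed.

End exponential_sums.

(** * Vertices of a convex hull as maximizers of linear functionals *)

Section vertices.
Context {R : realType} (n : nat).
Implicit Types u v w x y : 'rV[R]_n.

Lemma dotpC u v : dotp u v = dotp v u.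
Proof. by apply: eq_bigr => j _; rewrite mulrC. Qed.

Lemma dotpDl u v w : dotp (u + v) w = dotp u w + dotp v w.
Proof. by rewrite /dotp -big_split; apply: eq_bigr => j _; rewrite mxE mulrDl. Qed.

Lemma dotpZl (a : R) u v : dotp (a *: u) v = a * dotp u v.
Proof. by rewrite /dotp mulr_sumr; apply: eq_bigr => j _; rewrite mxE mulrA. Qed.

Lemma dotp_gt0 u : u != 0 -> 0 < dotp u u.
Proof.
move=> u0; rewrite lt_neqAle; apply/andP; split; last first.
  by apply: sumr_ge0 => j _; rewrite -expr2 sqr_ge0.
apply: contraNneq u0 => /esym/eqP.
rewrite psumr_eq0 => [/allP h|j _]; last by rewrite -expr2 sqr_ge0.
apply/eqP/rowP => j; rewrite mxE; have := h j (mem_index_enum _).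
by rewrite -expr2 sqrf_eq0 => /eqP.
Qed.

(** The set of points that are [v], or at which [u] is smaller than at [v], is
    convex and contains [X]. *)
Lemma exposed_vertex (X : set 'rV[R]_n) u v : X v ->
  (forall x, X x -> x != v -> dotp u x < dotp u v) -> vertices (convex_hull X) v.
Proof.
move=> Xv uX; split; first exact: sub_gen_smallest Xv.
exists u => x hx xv.
suff /(_ x hx) [xv'|//] : convex_hull X `<=` [set x | x = v \/ dotp u x < dotp u v].
  by rewrite xv' eqxx in xv.
apply: smallest_sub => [|y Xy /=]; last first.
  by have [->|yv] := eqVneq y v; [left|right; exact: uX].
apply/convex_setW => y z /set_mem /= hy /set_mem /= hz k k0 k1; apply/mem_set => /=.
have duv t : t = v \/ dotp u t < dotp u v -> dotp u t <= dotp u v.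
  by move=> [->//|/ltW].
have dk s t : dotp u (k%:num *: s + (1 - k%:num) *: t) =
    k%:num * dotp u s + (1 - k%:num) * dotp u t.
  by rewrite dotpC dotpDl !dotpZl !(dotpC _ u).
rewrite /conv/= /unstable.onem.
case: hy => [->|hy]; last first.
  by right; rewrite dk; have := duv z hz; nra.
case: hz => [->|hz]; last by right; rewrite dk; nra.
by left; rewrite -scalerDl addrC subrK scale1r.
Qed.

(** Among the maximizers of the inner product with [w], take [v] of maximal
    Euclidean norm. Then <a, v> < <v, v> for the other maximizers [a], so [v] is
    the only maximizer of the inner product with w + tau v if tau > 0 is small. *)
Lemma exists_vertex_max (A : {fset 'rV[R]_n}) w : (0 < #|` A|)%N ->
  exists2 v : A, vertices (convex_hull [set` A]) (val v) &
    forall a : A, dotp (val a) w <= dotp (val v) w.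
Proof.
rewrite cardfE => /card_gt0P[a0 _].
pose m := [arg max_(a > a0) dotp (val a) w]%O.
have mP (a : A) : dotp (val a) w <= dotp (val m) w.
  by rewrite /m; case: arg_maxP => // i _ h; exact: (h a isT).
pose P (a : A) := dotp (val a) w == dotp (val m) w.
pose v := [arg max_(a > m | P a) dotp (val a) (val a)]%O.
have [Pv vP] : P v /\ forall a, P a -> dotp (val a) (val a) <= dotp (val v) (val v).
  rewrite /v; case: arg_maxP => [|i Pi h]; first exact: eqxx.
  by split => // a Pa; exact: (h a Pa).
have vmax (a : A) : dotp (val a) w <= dotp (val v) w by rewrite (eqP Pv).
exists v => //.
(* tau is so small that the points at which the product with w is below the
   maximum remain below after the perturbation *)
pose del (a : A) : R := if P a then 1 else
  (dotp (val v) w - dotp (val a) w) / (`|dotp (val a) (val v) - dotp (val v) (val v)| + 1).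
pose tau := \big[Num.min/1]_a del a.
have D0 (a : A) : 0 < `|dotp (val a) (val v) - dotp (val v) (val v)| + 1.
  by rewrite ltr_wpDl.
have tau0 : 0 < tau.
  apply: lt_bigmin => // a _; rewrite /del; case: ifPn => // nPa.
  rewrite divr_gt0// subr_gt0 lt_neqAle vmax andbT.
  by apply: contraNneq nPa => h; rewrite /P h.
apply: (exposed_vertex (u := w + tau *: val v)); first exact: valP.
move=> x Ax xv.
rewrite !dotpDl !dotpZl !(dotpC w).
pose a : A := [` Ax]%fset.
rewrite -[x]/(val a) (dotpC (val v) (val a)).
case: (boolP (P a)) => Pa.
  rewrite (eqP Pa) (eqP Pv) ltrD2l ltr_pM2l//.
  have := dotp_gt0 (u := val a - val v); rewrite subr_eq0 => /(_ xv).
  rewrite dotpB !(dotpC (val a - val v)) !dotpB (dotpC (val v) (val a)).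
  by have := vP a Pa; lra.
have : tau <= del a by exact: bigmin_le_cond.
rewrite /del (negbTE Pa) ler_pdivlMr// => h.
have := ler_norm (dotp (val a) (val v) - dotp (val v) (val v)).
move: h; set N := `|_|; set p := dotp (val a) (val v); set q := dotp (val v) (val v).
by nra.
Qed.

End vertices.

(** * Newton events *)

Section newton_events.
Context {R : realType}.
Local Notation leb := (@lebesgue_measure R).
Local Notation gam := (@normal_prob R 0 1).
Local Notation peak := (@normal_peak R 1).
Variables (n : nat) (K : finType) (freq : K -> 'rV[R]_n) (v : K).
Local Notation J := {i : 'I_n & K}.
Implicit Types (w y : 'I_n -> R) (x : J -> R) (g : {ffun 'I_n -> K}).

Lemma integral_ball_indicator (q r : R) : 0 <= r ->
  (\int[leb]_s ((`|s - q| <= r)%R%:R)%:E = (2 * r)%:E)%E.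
Proof.
move=> r0; transitivity (\int[leb]_s (\1_(`[q - r, q + r]%classic) s)%:E)%E.
  apply: eq_integral => s _; rewrite indicE mem_setE in_itv/=; congr (_%:R%:E).
  by congr nat_of_bool; apply/idP/idP; rewrite ler_norml; lra.
rewrite integral_indic//= setIT lebesgue_measure_itv/= lte_fin.
rewrite -EFinB; case: ifPn => [_|]; first by congr (_%:E); ring.
by rewrite -leNgt => h; congr (_%:E); lra.
Qed.

Lemma measurable_natr_bool d (U : measurableType d) (b : U -> bool) :
  measurable_fun setT b -> measurable_fun setT (fun u => (b u)%:R : R).
Proof.
move=> mb; rewrite (_ : (fun u => _) = fun u => if b u then 1 else 0).
  by apply: measurable_fun_ifT => //; exact: measurable_cst.
by apply/funext => u; case: (b u).
Qed.

(** Dividing the system by exp <freq v, w> translates the frequencies and makes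
    the coefficients of [v] the constant terms. *)
Definition relfreq (a : K) : 'rV[R]_n := freq a - freq v.

Definition coefs x (i : 'I_n) (a : K) : R := x (existT _ i a).

Definition jac x w : 'M[R]_n := dexpsum_mx relfreq (coefs x) (rowu w).

Definition sys x w : 'cV[R]_n := expsum_col relfreq (coefs x) (rowu w).

Definition in_cone (eta : R) w : R := \prod_a (dotp (relfreq a) (rowu w) < eta)%R%:R.

(** The event that, up to eta and r, the point [w] looks like a zero assigned to
    [v]: the relative frequencies are below eta on [w], and the Newton correction
    at [w] has entries at most r. The correction is multiplied by the
    determinant, which replaces the inverse matrix by the adjugate. *)
Definition newton_indicator (eta r : R) w x : R :=
  in_cone eta w * ((\det (jac x w) != 0)%R%:R *
    \prod_j (`|(\adj (jac x w) *m sys x w) j 0| <= r * `|\det (jac x w)|)%R%:R).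

Lemma in_cone_ge0 eta w : 0 <= in_cone eta w.
Proof. by apply: prodr_ge0 => a _; exact: ler0n. Qed.

Lemma newton_indicator_ge0 eta r w x : 0 <= newton_indicator eta r w x.
Proof.
by rewrite !mulr_ge0 ?in_cone_ge0// prodr_ge0// => j _; exact: ler0n.
Qed.

Section measurability.
Context d (U : measurableType d) (h : U -> J -> R) (k : U -> 'I_n -> R).
Hypothesis mh : forall p, measurable_fun setT (h^~ p).
Hypothesis mk : forall i, measurable_fun setT (k^~ i).

Lemma measurable_dotp_rowu (b : 'rV[R]_n) :
  measurable_fun setT (fun u => dotp b (rowu (k u))).
Proof.
apply: measurable_sum => j; apply: measurable_funM => //.
by under eq_fun do rewrite mxE; exact: mk.
Qed.

Lemma measurable_expR_dotp (b : 'rV[R]_n) :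
  measurable_fun setT (fun u => expR (dotp b (rowu (k u)))).
Proof. by apply: measurableT_comp => //; exact: measurable_dotp_rowu. Qed.

Lemma measurable_jac i j : measurable_fun setT (fun u => jac (h u) (k u) i j).
Proof.
under eq_fun do rewrite mxE.
apply: measurable_sum => a; apply: measurable_funM; first exact: mh.
by apply: measurable_funM => //; exact: measurable_expR_dotp.
Qed.

Lemma measurable_sys i j : measurable_fun setT (fun u => sys (h u) (k u) i j).
Proof.
under eq_fun do rewrite mxE.
apply: measurable_sum => a; apply: measurable_funM; first exact: mh.
exact: measurable_expR_dotp.
Qed.

Lemma measurable_adj_jac i j : measurable_fun setT (fun u => (\adj (jac (h u) (k u))) i j).
Proof.
under eq_fun do rewrite mxE /cofactor.
apply: measurable_funM => //; apply: measurable_det => a b.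
by under eq_fun do rewrite mxE mxE; exact: measurable_jac.
Qed.

Lemma measurable_in_cone eta : measurable_fun setT (fun u => in_cone eta (k u)).
Proof.
apply: measurable_prod => a _; apply: measurable_natr_bool.
by apply: measurable_fun_ltr => //; exact: measurable_dotp_rowu.
Qed.

Lemma measurable_newton_indicator eta r :
  measurable_fun setT (fun u => (newton_indicator eta r (k u) (h u))%:E).
Proof.
have mdet : measurable_fun setT (fun u => \det (jac (h u) (k u))).
  by apply: measurable_det; exact: measurable_jac.
apply/measurable_EFinP; apply: measurable_funM; first exact: measurable_in_cone.
apply: measurable_funM.
  apply: measurable_natr_bool; apply: measurable_neg.
  by apply: measurable_fun_eqr => //; exact: measurable_cst.
apply: measurable_prod => j _; apply: measurable_natr_bool; apply: measurable_fun_ler.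
  apply: measurableT_comp => //; under eq_fun do rewrite mxE.
  apply: measurable_sum => i; apply: measurable_funM; first exact: measurable_adj_jac.
  exact: measurable_sys.
by apply: measurable_funM => //; exact: measurableT_comp.
Qed.

End measurability.

Definition base_idx (i : 'I_n) : J := existT _ i v.

Lemma base_idx_inj : injective base_idx.
Proof. by move=> i j []. Qed.

Lemma relfreqv : relfreq v = 0. Proof. by rewrite /relfreq subrr. Qed.

Lemma coefs_glue x y i a : a != v -> coefs (glue base_idx x y) i a = coefs x i a.
Proof.
by move=> av; rewrite /coefs glueN// => j; apply: contraNneq av => -[_ ->].
Qed.

Lemma coefs_gluev x y i : coefs (glue base_idx x y) i v = y i.
Proof. by rewrite /coefs (glueE base_idx_inj). Qed.

Lemma jac_glue x y w : jac (glue base_idx x y) w = jac x w.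
Proof.
apply/matrixP => i j; rewrite !mxE; apply: eq_bigr => a _.
have [->|av] := eqVneq a v; last by rewrite coefs_glue.
by rewrite relfreqv mxE mul0r !mulr0.
Qed.

(** The part of the system that does not involve the coefficients of [v]. *)
Definition sys0 x w : 'cV[R]_n := \col_i (sys x w i 0 - coefs x i v).

Lemma sys_glue x y w : sys (glue base_idx x y) w = \col_i y i + sys0 x w.
Proof.
apply/colP => i; rewrite !mxE /expsum (bigD1 v)//= [in RHS](bigD1 v)//= coefs_gluev.
rewrite relfreqv (_ : dotp 0 _ = 0) ?expR0 ?mulr1.
  rewrite addrAC subrr add0r; congr (_ + _).
  by apply: eq_bigr => a av; rewrite coefs_glue.
by apply: big1 => j _; rewrite mxE mul0r.
Qed.

(** In the coefficients y of [v] the system is y plus a constant, while the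
    Jacobian matrix D is constant. The substitution y = D u maps a cube of side
    2 r onto the event, with Jacobian |det D|. *)
Lemma integral_newton_indicator eta r w x : 0 <= r ->
  (iter_int leb (map base_idx (enum 'I_n)) (fun x => (newton_indicator eta r w x)%:E) x <=
   (in_cone eta w * (2 * r) ^+ n * `|\det (jac x w)|)%:E)%E.
Proof.
move=> r0; rewrite (iter_int_map base_idx_inj leb (enum 'I_n)).
set T := jac x w.
pose f y : \bar R := (\prod_(j <- enum 'I_n)
  (`|(\adj T *m (\col_i y i + sys0 x w)) j 0| <= r * `|\det T|)%R%:R)%:E.
have mf : coord_measurable f.
  move=> d U g mg; apply/measurable_EFinP; apply: measurable_prod => j _.
  apply: measurable_natr_bool; apply: measurable_fun_ler => //.
  apply: measurableT_comp => //; under eq_fun do rewrite mxE.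
  apply: measurable_sum => i; apply: measurable_funM => //.
  under eq_fun do rewrite !mxE.
  by apply: measurable_funD.
have f0 y : (0 <= f y)%E by rewrite lee_fin prodr_ge0.
have -> : ((fun x => (newton_indicator eta r w x)%:E) \o glue base_idx x) =
    fun y => ((in_cone eta w * (\det T != 0)%R%:R)%:E * f y)%E.
  apply/funext => y; rewrite /= /newton_indicator jac_glue sys_glue -/T -EFinM.
  by rewrite /f big_enum mulrA.
rewrite iter_int_mule//; last by rewrite lee_fin mulr_ge0// in_cone_ge0.
have [d0|d0] := eqVneq (\det T) 0.
  by rewrite /= mulr0 mul0e lee_fin !mulr_ge0 ?in_cone_ge0// exprn_ge0// mulr_ge0.
rewrite mulr1 -mulrA EFinM lee_wpmul2l ?lee_fin ?in_cone_ge0//.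
have uT : T \in unitmx by rewrite unitmxE unitfE.
rewrite -(linear_change uT _ mf f0) mulrC EFinM lee_wpmul2l ?lee_fin//.
pose q j := - ((\adj T *m sys0 x w) j 0 / \det T).
rewrite (_ : f \o mulv T = fun u => (\prod_(j <- enum 'I_n) (`|u j - q j| <= r)%R%:R)%:E).
  rewrite (@iter_int_prod R _ leb (enum 'I_n) (fun j s => (`|s - q j| <= r)%R%:R) (2 * r)).
  - by rewrite size_enum_ord.
  - exact: enum_uniq.
  - move=> i; apply: measurable_natr_bool; apply: measurable_fun_ler => //.
    by apply: measurableT_comp => //; exact: measurable_funB.
  - by [].
  - by move=> i; exact: integral_ball_indicator.
apply/funext => u; rewrite /f /=; congr (_%:E); apply: eq_bigr => j _.
congr (nat_of_bool _)%:R.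
have -> : \col_i mulv T u i = T *m \col_i u i.
  apply/colP => i; rewrite [LHS]mxE [RHS]mxE; apply: eq_bigr => k _.
  by rewrite [(\col_i u i) _ _]mxE.
rewrite mulmxDr mulmxA mul_adj_mx mul_scalar_mx mxE.
rewrite [X in X + _]mxE [X in _ * X + _]mxE /q opprK.
have -> : \det T * u j + (\adj T *m sys0 x w) j 0 =
    \det T * (u j + (\adj T *m sys0 x w) j 0 / \det T).
  by rewrite mulrDr mulrCA divff// mulr1.
by rewrite normrM (mulrC `|_|) ler_pM2r// normr_gt0.
Qed.

End newton_events.

(** * Probability and volume of Newton events *)

Section expectations.
Context {R : realType} d (T : measurableType d) (P : probability T R).
Local Notation leb := (@lebesgue_measure R).
Local Notation gam := (@normal_prob R 0 1).
Local Notation peak := (@normal_peak R 1).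
Variables (n : nat) (K : finType) (freq : K -> 'rV[R]_n).
Local Notation J := {i : 'I_n & K}.
Variable X : J -> {RV P >-> R}.
Hypothesis X_gaussian : forall j, standard_gaussian (X j).
Hypothesis X_indep : mutually_independent X.
Variable v : K.
Implicit Types (w : 'I_n -> R) (g : {ffun 'I_n -> K}) (t : T).

Local Notation Xat t := (fun j : J => X j t).

Lemma measurable_Xat j : measurable_fun setT (X j).
Proof. exact: measurable_funP. Qed.

Lemma measurable_colsel_det g :
  measurable_fun setT (fun t => `|\det (colsel (coefs (Xat t)) g)|).
Proof.
apply: measurableT_comp => //; apply: measurable_det => i j.
by under eq_fun do rewrite mxE; exact: measurable_Xat.
Qed.

(** As [g] is injective, the selected coefficients are distinct, hence form a
    standard Gaussian matrix. *)
Lemma expectation_colsel g : injective g ->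
  (\int[P]_t `|\det (colsel (coefs (Xat t)) g)|%:E = @absdet_int R n)%E.
Proof.
move=> ginj.
pose h (p : 'I_n * 'I_n) : J := existT _ p.1 (g p.2).
have hinj : injective h by move=> [a b] [a' b'] [/= -> /ginj ->].
pose F (x : J -> R) : \bar R := `|\det (mx_of_pairs (x \o h))|%:E.
have mF : coord_measurable F by move=> d' U k mk; apply: (@coord_measurable_absdet R n) => p; exact: mk.
have F0 x : (0 <= F x)%E by rewrite lee_fin.
transitivity (\int[P]_t F (Xat t))%E.
  apply: eq_integral => t _; rewrite /F.
  suff -> : mx_of_pairs ((fun j => X j t) \o h) = colsel (coefs (Xat t)) g by [].
  by apply/matrixP => i j; rewrite !mxE.
rewrite (integral_replaces X_gaussian X_indep (map h (enum {: 'I_n * 'I_n})) mF F0).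
transitivity (\int[P]_t (cst (@absdet_int R n) t))%E.
  apply: eq_integral => t _ /=; rewrite (iter_int_map_comp hinj gam (enum {: 'I_n * 'I_n}) (fun x => `|\det (mx_of_pairs x)|%:E)).
  by apply: iter_int_eq => p; rewrite mem_enum.
by rewrite integral_cst//= probability_setT mule1.
Qed.

Definition freq_exp w (a : K) (j : 'I_n) : R :=
  relfreq freq v a 0 j * expR (dotp (relfreq freq v a) (rowu w)).

Lemma jac_prodmx (x : J -> R) w : jac freq v x w = prodmx (coefs x) (freq_exp w).
Proof. by rewrite /jac /prodmx; apply/matrixP => i j; rewrite !mxE. Qed.

Local Notation inj_avoiding :=
  (enum [set g : {ffun 'I_n -> K} in ffun_on (predC1 v) | injectiveb g]%SET).

Lemma measurable_absdet_jac w : measurable_fun setT (fun t => `|\det (jac freq v (Xat t) w)|).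
Proof.
apply: measurableT_comp => //; apply: measurable_det => i j.
apply: (@measurable_jac R n K freq v _ _ (fun t => Xat t) (fun=> w)).
- exact: measurable_Xat.
- by move=> k; exact: measurable_cst.
Qed.

(** By Cauchy-Binet: the minors of the coefficient matrix all have the same
    expected absolute value. *)
Lemma expectation_det w :
  ((peak ^+ n)%:E * \int[P]_t `|\det (jac freq v (Xat t) w)|%:E <=
   ((n`!%:R)^-1 * (vol_proj R n)^-1 *
     \sum_(g <- inj_avoiding) `|\det (rowsel (freq_exp w) g)|)%:E)%E.
Proof.
have f0 : 0 < (n`!%:R : R) by rewrite ltr0n fact_gt0.
have p0 : (0 <= (peak ^+ n)%:E :> \bar R)%E by rewrite lee_fin exprn_ge0// normal_peak_ge0.
have -> : (\int[P]_t `|\det (jac freq v (Xat t) w)|%:E =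
    (n`!%:R^-1)%:E * \int[P]_t (n`!%:R * `|\det (jac freq v (Xat t) w)|)%:E)%E.
  rewrite -ge0_integralZl_EFin//; last first.
    by apply/measurable_EFinP; apply: measurable_funM => //; exact: measurable_absdet_jac.
  by apply: eq_integral => t _; rewrite -EFinM mulrA mulVf ?gt_eqF// mul1r.
apply: (@le_trans _ _ ((peak ^+ n)%:E * ((n`!%:R^-1)%:E *
    \sum_(g <- inj_avoiding) `|\det (rowsel (freq_exp w) g)|%:E * @absdet_int R n))%E).
  apply: lee_wpmul2l => //; apply: lee_wpmul2l; first by rewrite lee_fin invr_ge0 ltW.
  apply: (@le_trans _ _ (\int[P]_t \sum_(g <- inj_avoiding)
      (`|\det (rowsel (freq_exp w) g)|%:E * `|\det (colsel (coefs (Xat t)) g)|%:E))%E).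
    apply: ge0_le_integral => //.
    - apply/measurable_EFinP; apply: measurable_funM => //.
      exact: measurable_absdet_jac.
    - apply: emeasurable_sum => g.
      by apply: measurable_funeM; apply/measurable_EFinP; exact: measurable_colsel_det.
    move=> t _.
    under eq_bigr do rewrite -EFinM.
    rewrite sumEFin lee_fin jac_prodmx.
    apply: le_trans (norm_det_prodmx_le _ (v := v) _) _.
      by move=> j; rewrite /freq_exp relfreqv mxE mul0r.
    by rewrite big_enum; apply: ler_sum => g _; rewrite mulrC.
  rewrite ge0_integral_sum//; last first.
    by move=> g; apply: measurable_funeM; apply/measurable_EFinP; exact: measurable_colsel_det.
  rewrite big_seq [leRHS]big_seq.
  apply: lee_sum => g; rewrite mem_enum inE => /andP[_ /injectiveP ginj].
  rewrite ge0_integralZl_EFin//; last by apply/measurable_EFinP; exact: measurable_colsel_det.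
  by rewrite expectation_colsel.
have a0 : (0 <= @absdet_int R n)%E by apply: iter_int_ge0 => x; rewrite lee_fin.
rewrite -ge0_sume_distrl; last by move=> g _; rewrite lee_fin.
rewrite sumEFin (muleC (\sum_(g <- _) _)%:E) !muleA (muleC (peak ^+ n)%:E) -!muleA.
rewrite (muleA (peak ^+ n)%:E) -mulrA !EFinM.
apply: lee_wpmul2l; first by rewrite lee_fin invr_ge0 ltW.
apply: lee_wpmul2r; first by rewrite lee_fin sumr_ge0.
exact: absdet_int_le.
Qed.

(** The coefficients of [v] are integrated out first, with their density bounded
    by its peak; what remains is |det D|. *)
Lemma expectation_newton_indicator eta r w : 0 <= r ->
  (\int[P]_t (newton_indicator freq v eta r w (Xat t))%:E <=
   (in_cone freq v eta w * (2 * r) ^+ n * ((n`!%:R)^-1 * (vol_proj R n)^-1 *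
     \sum_(g <- inj_avoiding) `|\det (rowsel (freq_exp w) g)|))%:E)%E.
Proof.
move=> r0.
have mN : coord_measurable (fun x => (newton_indicator freq v eta r w x)%:E).
  move=> d' U h mh; apply: (@measurable_newton_indicator _ _ _ freq v _ _ h (fun=> w)) => //.
have N0 x : (0 <= (newton_indicator freq v eta r w x)%:E)%E by rewrite lee_fin newton_indicator_ge0.
set c := in_cone freq v eta w * (2 * r) ^+ n.
have c0 : 0 <= c by rewrite mulr_ge0 ?in_cone_ge0// exprn_ge0// mulr_ge0.
have p0 : 0 <= peak ^+ n by rewrite exprn_ge0// normal_peak_ge0.
rewrite (integral_replaces X_gaussian X_indep (map (base_idx v) (enum 'I_n)) mN N0).
apply: (@le_trans _ _ (\int[P]_t ((peak ^+ n * c)%:E * `|\det (jac freq v (Xat t) w)|%:E))%E).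
  apply: ge0_le_integral => //.
  - by move=> t _; exact: iter_int_ge0.
  - by apply: (coord_measurable_iter_int gam _ mN N0); exact: measurable_Xat.
  - by apply: measurable_funeM; apply/measurable_EFinP; exact: measurable_absdet_jac.
  move=> t _; apply: le_trans (iter_int_normal_le _ _ mN N0) _.
  rewrite size_map size_enum_ord EFinM -muleA; apply: lee_wpmul2l; first by rewrite lee_fin.
  exact: integral_newton_indicator.
rewrite ge0_integralZl_EFin//; last 2 first.
- by apply/measurable_EFinP; exact: measurable_absdet_jac.
- exact: mulr_ge0.
rewrite mulrC EFinM -muleA [leRHS]EFinM; apply: lee_wpmul2l; first by rewrite lee_fin.
exact: expectation_det.
Qed.

Lemma coord_measurable_in_cone_rowsel eta g :
  coord_measurable (fun w => (in_cone freq v eta w * `|\det (rowsel (freq_exp w) g)|)%:E).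
Proof.
move=> d' U k mk; apply/measurable_EFinP; apply: measurable_funM.
  exact: measurable_in_cone.
apply: measurableT_comp => //; apply: measurable_det => i j.
under eq_fun do rewrite mxE; apply: measurable_funM => //.
exact: measurable_expR_dotp.
Qed.

(** With B the matrix of the selected frequencies b_i, the minor is det B times
    the product of the exp <b_i, w>. The substitution s = B w and the constraints
    s_i < eta of the cone leave a product of integrals of exp over rays. *)
Lemma integral_in_cone_rowsel eta g :
  (iter_int leb (enum 'I_n)
     (fun w => (in_cone freq v eta w * `|\det (rowsel (freq_exp w) g)|)%:E) (fun=> 0%R)
   <= (expR eta ^+ n)%:E)%E.
Proof.
pose B : 'M[R]_n := \matrix_(i, j) relfreq freq v (g i) 0 j.
have Bw w i : dotp (relfreq freq v (g i)) (rowu w) = mulv B w i.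
  by apply: eq_bigr => j _; rewrite !mxE.
have detE w : \det (rowsel (freq_exp w) g) = (\prod_i expR (mulv B w i)) * \det B.
  have -> : rowsel (freq_exp w) g = diag_mx (\row_i expR (mulv B w i)) *m B.
    by apply/matrixP => i j; rewrite mul_diag_mx !mxE /freq_exp Bw mulrC /relfreq !mxE.
  by rewrite det_mulmx det_diag; congr (_ * _); apply: eq_bigr => i _; rewrite mxE.
pose e (s : R) : R := if 0 < eta - s then expR s else 0.
have e0 s : 0 <= e s by rewrite /e; case: ifP => // _; exact: expR_ge0.
have me : measurable_fun setT e.
  by apply: measurable_pos_if => //; exact: measurable_funB.
pose f (s : 'I_n -> R) : \bar R := (\prod_(i <- enum 'I_n) e (s i))%:E.
have mf : coord_measurable f.
  move=> d' U k mk; apply/measurable_EFinP; apply: measurable_prod => i _.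
  exact: measurableT_comp.
have f0 s : (0 <= f s)%E by rewrite lee_fin prodr_ge0.
apply: (@le_trans _ _ (iter_int leb (enum 'I_n) (fun w => `|\det B|%:E * (f \o mulv B) w)%E (fun=> 0%R))).
  apply: le_iter_int.
  - exact: coord_measurable_in_cone_rowsel.
  - by move=> d' U k mk; apply: measurable_funeM; exact: (coord_measurable_mulv B mf).
  - by move=> w; rewrite lee_fin mulr_ge0// in_cone_ge0.
  move=> w; rewrite detE normrM mulrA mulrC -EFinM lee_fin ler_wpM2l//.
  rewrite normr_prod /f /= big_enum/=.
  have [/forallP h|] := boolP [forall i, mulv B w i < eta].
    rewrite (eq_bigr (fun i => e (mulv B w i))) => [|i _]; last first.
      by rewrite /e subr_gt0 h ger0_norm// expR_ge0.
    rewrite ler_piMl ?prodr_ge0//; apply: prodr_ile1 => a _.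
    by rewrite ler0n /=; case: (_ < _)%R.
  move=> /forallPn[i]; rewrite -Bw => /negbTE h.
  by rewrite /in_cone (bigD1 (g i))//= h !mul0r prodr_ge0.
rewrite iter_int_mule//; [|exact: coord_measurable_mulv|by move=> w; exact: f0].
have [->|d0] := eqVneq (\det B) 0.
  by rewrite normr0 mul0e lee_fin exprn_ge0// expR_ge0.
rewrite linear_change ?unitmxE ?unitfE//.
rewrite (@iter_int_prod R _ leb (enum 'I_n) (fun=> e) (expR eta)) ?enum_uniq ?size_enum_ord//.
by move=> i; exact: integral_expR_ray.
Qed.

(** The factorial from Cauchy-Binet cancels the number of orderings of an
    [n]-subset. *)
Lemma integral_expectation_newton_indicator eta r : 0 <= r ->
  (iter_int leb (enum 'I_n) (fun w => \int[P]_t (newton_indicator freq v eta r w (Xat t))%:E) (fun=> 0%R)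
   <= ((2 * r * expR eta) ^+ n * (vol_proj R n)^-1 * 'C(#|K|.-1, n)%:R)%:E)%E.
Proof.
move=> r0.
have v0 : 0 < vol_proj R n by have [] := cauchy_intE (R := R) n.
have f0 : 0 < (n`!%:R : R) by rewrite ltr0n fact_gt0.
set c := (2 * r) ^+ n * ((n`!%:R)^-1 * (vol_proj R n)^-1).
have c0 : 0 <= c.
  by rewrite mulr_ge0 ?exprn_ge0 ?mulr_ge0// invr_ge0 ltW.
have m1 : coord_measurable (fun w => (\int[P]_t (newton_indicator freq v eta r w (Xat t))%:E)%E).
  apply: coord_measurable_integral => [d' U h k mh mk|t w]; last by rewrite lee_fin newton_indicator_ge0.
  apply: measurable_newton_indicator => // p.
  by apply: (measurableT_comp (measurable_Xat p)).
have m2 : coord_measurable (fun w => \sum_(g <- inj_avoiding)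
    (in_cone freq v eta w * `|\det (rowsel (freq_exp w) g)|)%:E)%E.
  by move=> d' U k mk; apply: emeasurable_sum => g; exact: coord_measurable_in_cone_rowsel.
have s0 w g : (0 <= (in_cone freq v eta w * `|\det (rowsel (freq_exp w) g)|)%:E)%E.
  by rewrite lee_fin mulr_ge0// in_cone_ge0.
apply: (@le_trans _ _ (iter_int leb (enum 'I_n) (fun w => c%:E * \sum_(g <- inj_avoiding)
    (in_cone freq v eta w * `|\det (rowsel (freq_exp w) g)|)%:E)%E (fun=> 0%R))).
  apply: le_iter_int => //.
  - by move=> d' U k mk; apply: measurable_funeM; exact: m2.
  - by move=> w; apply: integral_ge0 => t _; rewrite lee_fin newton_indicator_ge0.
  move=> w; apply: le_trans (expectation_newton_indicator eta w r0) _.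
  by rewrite sumEFin -EFinM lee_fin -mulr_sumr /c le_eqVlt; apply/orP; left; apply/eqP; ring.
rewrite iter_int_mule//; last by move=> w; apply: sume_ge0.
rewrite iter_int_sum; last 2 first.
- by move=> g; exact: coord_measurable_in_cone_rowsel.
- by move=> g w; exact: s0.
apply: (@le_trans _ _ (c%:E * \sum_(g <- inj_avoiding) (expR eta ^+ n)%:E)%E).
  apply: lee_wpmul2l; first by rewrite lee_fin.
  apply: lee_sum => g _; exact: integral_in_cone_rowsel.
rewrite sumEFin big_enum sumr_const card_injections_avoiding -EFinM lee_fin /c.
rewrite -[X in _ * X <= _]mulr_natr natrM [in leRHS]exprMn.
set a := (2 * r) ^+ n; set b := expR eta ^+ n; set F := n`!%:R; set u := (vol_proj R n)^-1.
rewrite (_ : _ * _ = a * b * u * 'C(#|K|.-1, n)%:R * (F^-1 * F)); last by ring.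
by rewrite mulVf ?mulr1// gt_eqF.
Qed.

End expectations.

(** * Counting zeros by Newton events *)

Section lower_limits.
Context {R : realType}.
Implicit Types (u : (\bar R)^nat) (a : \bar R).

Lemma limn_einf_ge u a : (\forall k \near \oo, a <= u k)%E -> (a <= limn_einf u)%E.
Proof.
move=> [N _ hN]; rewrite limn_einf_lim; apply: lime_ge; first exact: is_cvg_einfs.
exists N => // k /= Nk; apply: le_ereal_inf_tmp => _ [m /= km <-].
by apply: hN; exact: leq_trans km.
Qed.

Lemma limn_einf_le u a : (forall k, u k <= a)%E -> (limn_einf u <= a)%E.
Proof.
move=> ua; rewrite limn_einf_lim; apply: lime_le; first exact: is_cvg_einfs.
apply: nearW => k; apply: le_trans (ua k).
by apply: ereal_inf_lbound; exists k => /=.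
Qed.

(** Read off from the integral as a supremum over simple functions; the number of
    zeros is compared in this way with measurable functions. *)
Lemma ge0_le_integralT d (T : measurableType d) (mu : {measure set T -> \bar R})
    (f g : T -> \bar R) :
  (forall x, 0 <= f x)%E -> (forall x, f x <= g x)%E ->
  (\int[mu]_x f x <= \int[mu]_x g x)%E.
Proof.
move=> f0 fg; have g0 x : (0 <= g x)%E by exact: le_trans (f0 x) (fg x).
rewrite (ge0_integralTE _ f0) (ge0_integralTE _ g0).
apply: ereal_sup_le => _ [h /= hf <-]; exists h => //= x.
exact: le_trans (hf x) (fg x).
Qed.

(** An infinite set has finite subsets of every size. *)
Lemma counting_le (U : choiceType) (Z : set U) a :
  (forall (m : nat) (z : 'I_m -> U), injective z -> (forall i, Z (z i)) ->
    (m%:R%:E <= a)%E) ->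
  (counting Z <= a)%E.
Proof.
move=> h.
have hB (B : {fset U}) : [set` B] `<=` Z -> ((#|` B|)%:R%:E <= a)%E.
  move=> BZ; apply: (h _ (fun i => val (enum_val (cast_ord (cardfE B) i)))).
    by move=> i j /val_inj/enum_val_inj/cast_ord_inj.
  by move=> i; apply: BZ => /=; exact: valP.
rewrite /counting; case: asboolP => [fZ|/infinite_set_fset nZ].
  by apply: hB; rewrite fset_setK.
rewrite leye_eq; apply/eqP/eqyP => A A0.
have [B BZ AB] := nZ (Num.trunc A).+1.
apply: le_trans (hB B BZ); rewrite lee_fin.
apply: le_trans (_ : (Num.trunc A).+1%:R <= _); last by rewrite ler_nat.
by apply/ltW; apply: truncnS_gt.
Qed.

End lower_limits.

Section counting_zeros.
Context {R : realType} (n : nat) (A : {fset 'rV[R]_n}) (c : 'I_n -> A -> R).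
Hypothesis A_neq0 : (0 < #|` A|)%N.
Variable eta : R.
Hypothesis eta0 : 0 < eta.
Local Notation leb := (@lebesgue_measure R).
Local Notation freq := (val : A -> 'rV[R]_n).
Local Notation Z := (nondegenerate_zeros (exp_system (A := fun=> A) c)).
Local Notation x := (fun ia : {i : 'I_n & A} => c (tag ia) (tagged ia)).

Definition is_vertex (v : A) : bool := `[< vertices (convex_hull [set` A]) (val v) >].
Definition hull_vertices : seq A := enum is_vertex.

(** At a zero, the derivative of the factor exp (- <v, w>) does not contribute. *)
Lemma dexpsum_relfreq (v : A) z : (forall i, expsum freq (c i) z = 0) ->
  dexpsum_mx (relfreq freq v) c z = expR (- dotp (val v) z) *: dexpsum_mx freq c z.
Proof.
move=> z0; apply/matrixP => i j; rewrite !mxE /dexpsum.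
have dE a : expR (dotp (relfreq freq v a) z) = expR (- dotp (val v) z) * expR (dotp (val a) z).
  by rewrite -expRD /relfreq dotpC dotpB !(dotpC z) addrC.
under eq_bigr do rewrite dE /relfreq !mxE.
rewrite (eq_bigr (fun a => expR (- dotp (val v) z) * (c i a * (val a 0 j * expR (dotp (val a) z)))
  - expR (- dotp (val v) z) * val v 0 j * (c i a * expR (dotp (val a) z)))); last by move=> a _; ring.
by rewrite sumrB -!mulr_sumr (z0 i : \sum_a _ = 0) mulr0 subr0.
Qed.

Lemma expsum_relfreq (v : A) z i :
  expsum (relfreq freq v) (c i) z = expR (- dotp (val v) z) * expsum freq (c i) z.
Proof.
rewrite /expsum mulr_sumr; apply: eq_bigr => a _.
by rewrite /relfreq dotpC dotpB !(dotpC z) addrC expRD mulrCA.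
Qed.

(** For a vertex [v] that maximizes the inner product with [z], the relative
    frequencies are at most 0 on [z], hence below eta near [z]. *)
Lemma zero_detected z : Z z -> exists2 v : A, is_vertex v &
  exists2 rho : R, 0 < rho & forall eps (w : 'I_n -> R), 0 < eps -> eps <= rho ->
    (forall j, `|w j - z 0 j| <= eps) ->
    newton_indicator freq v eta ((1 + eta) * eps) w x = 1.
Proof.
move=> [Fz Jz].
have z0 i : expsum freq (c i) z = 0 by have /rowP/(_ i) := Fz; rewrite !mxE.
have [v vV vmax] := exists_vertex_max z A_neq0.
exists v; first exact/asboolP.
have {}Jz : \det (dexpsum_mx (relfreq freq v) c z) != 0.
  rewrite dexpsum_relfreq// detZ mulf_neq0 ?expf_neq0 ?(gt_eqF (expR_gt0 _))//.
  by rewrite -det_tr -jacobian_expsum.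
have [rho1 rho10 newton] := newton_step_small eta0
  (fun i => etrans (expsum_relfreq v z i) (etrans (congr1 _ (z0 i)) (mulr0 _))) Jz.
have [rho2 rho20 cone] : exists2 rho2 : R, 0 < rho2 & forall w : 'rV[R]_n, `|w - z| <= rho2 ->
    forall a, dotp (relfreq freq v a) w < eta.
  apply: near_closed_ball; 
  apply: (@filter_forall _ _ (fun (a : A) (w : 'rV[R]_n) => dotp (relfreq freq v a) w < eta) (nbhs z) _) => a.
  have : dotp (relfreq freq v a) z < eta.
    by rewrite /relfreq dotpC dotpB !(dotpC z) (le_lt_trans _ eta0)// subr_le0.
  exact: cvgr_lt (@continuous_dotp R n (relfreq freq v a) z) _.
exists (Num.min rho1 rho2); first by rewrite lt_min rho10.
move=> eps w eps0; rewrite le_min => /andP[er1 er2] wz.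
have {}wz : `|rowu w - z| <= eps.
  by apply: rV_norm_le => [|j]; [exact: ltW|rewrite !mxE; exact: wz].
have [d0 dn] := newton _ _ eps0 er1 wz.
rewrite /newton_indicator /in_cone big1 => [|a _]; last by rewrite cone// (le_trans wz).
rewrite mul1r [\det _ != 0]d0 mul1r big1// => j _.
by rewrite [_ <= _]dn.
Qed.

Definition box (z : 'rV[R]_n) (eps : R) (w : 'I_n -> R) : R :=
  \prod_(j <- enum 'I_n) (`|w j - z 0 j| <= eps)%R%:R.

Lemma boxP z eps w : box z eps w = [forall j, `|w j - z 0 j| <= eps]%:R.
Proof.
rewrite /box big_enum/=; have [/forallP h|/forallPn[j /negbTE h]] :=
  boolP [forall j, `|w j - z 0 j| <= eps].
  by rewrite big1// => j _; rewrite h.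
by rewrite (bigD1 j)//= h mul0r.
Qed.

Lemma coord_measurable_box z eps : coord_measurable (fun w => (box z eps w)%:E).
Proof.
move=> d U g mg; apply/measurable_EFinP; apply: measurable_prod => j _.
apply: measurable_natr_bool; apply: measurable_fun_ler => //.
by apply: measurableT_comp => //; apply: measurable_funB.
Qed.

Lemma box_ge0 z eps w : 0 <= box z eps w.
Proof. by rewrite boxP ler0n. Qed.

Lemma integral_box z eps w : 0 <= eps ->
  iter_int leb (enum 'I_n) (fun w => (box z eps w)%:E) w = ((2 * eps) ^+ n)%:E.
Proof.
move=> eps0; rewrite (@iter_int_prod R _ leb (enum 'I_n) (fun j s => (`|s - z 0 j| <= eps)%R%:R) (2 * eps)).
- by rewrite size_enum_ord.
- exact: enum_uniq.
- move=> i; apply: measurable_natr_bool; apply: measurable_fun_ler => //.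
  by apply: measurableT_comp => //; exact: measurable_funB.
- by [].
- by move=> i; exact: integral_ball_indicator.
Qed.

(** The volume of the Newton events in units of the cube of radius eps. *)
Definition newton_volume (eps : R) : \bar R :=
  (\sum_(v <- hull_vertices) (((2 * eps) ^+ n)^-1)%:E *
    iter_int leb (enum 'I_n) (fun w => (newton_indicator freq v eta ((1 + eta) * eps) w x)%:E) (fun=> 0%R))%E.

(** For small eps the cubes of radius eps around the zeros are disjoint, and each
    lies in the Newton event of the vertex to which its centre is assigned. *)
Lemma newton_volume_ge (m : nat) (z : 'I_m -> 'rV[R]_n) :
  injective z -> (forall i, Z (z i)) ->
  exists2 rho : R, 0 < rho & forall eps, 0 < eps -> eps <= rho ->
    (m%:R%:E <= newton_volume eps)%E.
Proof.
move=> z_inj zZ.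
have /choice[v vP] i : exists v, is_vertex v /\
    exists2 rho : R, 0 < rho & forall eps (w : 'I_n -> R), 0 < eps -> eps <= rho ->
    (forall j, `|w j - z i 0 j| <= eps) ->
    newton_indicator freq v eta ((1 + eta) * eps) w x = 1.
  by have [v vV h] := zero_detected (zZ i); exists v.
have vV i : is_vertex (v i) by have [] := vP i.
have /choice[rho rhoP] i : exists rho : R, 0 < rho /\ forall eps (w : 'I_n -> R),
    0 < eps -> eps <= rho -> (forall j, `|w j - z i 0 j| <= eps) ->
    newton_indicator freq (v i) eta ((1 + eta) * eps) w x = 1.
  by have [_ [r r0 h]] := vP i; exists r.
(* a third of the smallest distance: closed cubes of this radius are disjoint *)
pose sep := \big[Num.min/1]_(p : 'I_m * 'I_m | p.1 != p.2) (`|z p.1 - z p.2| / 3).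
pose rad := \big[Num.min/1]_i rho i.
exists (Num.min sep rad).
  rewrite lt_min; apply/andP; split; apply: lt_bigmin => //.
    by move=> p np; rewrite divr_gt0// normr_gt0 subr_eq0; apply: contra np => /eqP/z_inj ->.
  by move=> i _; have [] := rhoP i.
move=> eps eps0; rewrite le_min => /andP[eps_sep eps_rad].
have c0 : 0 < (2 * eps) ^+ n by rewrite exprn_gt0// mulr_gt0.
have mN u : coord_measurable (fun w => (newton_indicator freq u eta ((1 + eta) * eps) w x)%:E).
  move=> d U g mg; apply: (@measurable_newton_indicator _ _ _ freq u _ _ (fun=> x) g) => // p.
rewrite /newton_volume -ge0_sume_distrr; last first.
  by move=> u _; apply: iter_int_ge0 => w; rewrite lee_fin newton_indicator_ge0.
rewrite -iter_int_sum => [|//|u w]; last by rewrite lee_fin newton_indicator_ge0.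
have -> : m%:R%:E = ((((2 * eps) ^+ n)^-1)%:E *
    iter_int leb (enum 'I_n) (fun w => \sum_(i <- enum 'I_m) (box (z i) eps w)%:E) (fun=> 0%R))%E.
  rewrite iter_int_sum => [|i|i w]; [|exact: coord_measurable_box|by rewrite lee_fin box_ge0].
  rewrite big_enum (eq_bigr (fun=> ((2 * eps) ^+ n)%:E)) => [|i _]; last first.
    by rewrite integral_box// ltW.
  by rewrite sumEFin sumr_const card_ord -EFinM -[_ ^+ n *+ _]mulr_natr mulrA mulVf ?mul1r// gt_eqF.
apply: lee_wpmul2l; first by rewrite lee_fin invr_ge0 ltW.
apply: le_iter_int.
- by move=> d U g mg; apply: emeasurable_sum => i; exact: coord_measurable_box.
- by move=> d U g mg; apply: emeasurable_sum => u; exact: mN.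
- by move=> w; apply: sume_ge0 => i _; rewrite lee_fin box_ge0.
move=> w; rewrite !sumEFin lee_fin big_enum/=.
have N0 u : 0 <= newton_indicator freq u eta ((1 + eta) * eps) w x by exact: newton_indicator_ge0.
have [/existsP[i /forallP wi]|/existsPn none] :=
  boolP [exists i, [forall j, `|w j - z i 0 j| <= eps]]; last first.
  rewrite big1 => [|i _]; first by apply: sumr_ge0.
  by rewrite boxP (negbTE (none i)).
rewrite (bigD1 i)//= big1 => [|k ki]; last first.
  rewrite boxP; case: forallP => // wk; exfalso.
  have sep_ik : sep <= `|z i - z k| / 3.
    by apply: (bigmin_le_cond 1 (fun p : 'I_m * 'I_m => `|z p.1 - z p.2| / 3) (j := (i, k))); rewrite /= eq_sym.
  move: (le_trans eps_sep sep_ik).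
  rewrite ler_pdivlMr// leNgt => /negP; apply.
  apply: (@le_lt_trans _ _ (2 * eps)); last by rewrite mulrC ltr_pM2l//; lra.
  apply: rV_norm_le => [|j]; first by rewrite mulr_ge0// ltW.
  rewrite !mxE (_ : _ - _ = (w j - z k 0 j) - (w j - z i 0 j)); last by ring.
  by apply: le_trans (ler_normB _ _) _; have := wi j; have := wk j; lra.
rewrite addr0; apply: (@le_trans _ _ (newton_indicator freq (v i) eta ((1 + eta) * eps) w x)).
  have [_ ->//] := rhoP i; first by rewrite boxP; case: forallP.
  by apply: le_trans eps_rad _; exact: bigmin_le_cond.
rewrite big_enum/= (bigD1 (v i))/=; last exact: vV.
by rewrite lerDl sumr_ge0.
Qed.

Lemma counting_le_newton_volume :
  (counting Z <= limn_einf (fun k => newton_volume (harmonic k)))%E.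
Proof.
apply: counting_le => m z z_inj zZ; apply: limn_einf_ge.
have [rho rho0 h] := newton_volume_ge z_inj zZ.
have /(_ _ rho rho0) := cvgr_lt _ (@cvg_harmonic R).
apply: filterS => k hk; apply: h; first exact: harmonic_gt0.
exact: ltW.
Qed.

End counting_zeros.

(** * The bound on the expected number of zeros *)

Section expected_count.
Context {R : realType} (n : nat) (A : {fset 'rV[R]_n}).
Context d (T : measurableType d) (P : probability T R) (c : 'I_n -> A -> {RV P >-> R}).
Hypothesis A_neq0 : (0 < #|` A|)%N.
Hypothesis c_gaussian : iid_standard_gaussian (A := fun=> A) c.
Local Notation leb := (@lebesgue_measure R).
Local Notation X := (fun ia : {i : 'I_n & A} => c (tag ia) (tagged ia)).
Local Notation volume eta eps t := (newton_volume (fun i a => c i a t) eta eps).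

Lemma measurable_newton_volume eta eps :
  measurable_fun setT (fun t => volume eta eps t).
Proof.
apply: emeasurable_sum => v; apply: measurable_funeM.
have := @param_measurable_iter_int R _ _ T leb (enum 'I_n) (fun t w =>
  (newton_indicator (val : A -> _) v eta ((1 + eta) * eps) w (fun ia => X ia t))%:E) _ _ _ T id (fun=> fun=> 0%R).
apply.
- move=> d' U h g mh mg; apply: measurable_newton_indicator => // p.
  exact: (measurableT_comp (measurable_funP (X p))).
- by move=> t w; rewrite lee_fin newton_indicator_ge0.
- exact: measurable_id.
- by move=> i; exact: measurable_cst.
Qed.

Lemma newton_volume_ge0 eta eps t : 0 <= eps -> (0 <= volume eta eps t)%E.
Proof.
move=> eps0; apply: sume_ge0 => v _; apply: mule_ge0.
  by rewrite lee_fin invr_ge0 exprn_ge0// mulr_ge0.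
by apply: iter_int_ge0 => w; rewrite lee_fin newton_indicator_ge0.
Qed.

(** Tonelli exchanges expectation and volume; the volume of the cube cancels up to
    the factor (1 + eta)^n of the tolerance of the Newton events. *)
Lemma expectation_newton_volume eta eps : 0 <= eta -> 0 < eps ->
  (\int[P]_t volume eta eps t <=
   ((size (hull_vertices A))%:R * (((1 + eta) * expR eta) ^+ n * (vol_proj R n)^-1 *
     'C(#|` A|.-1, n)%:R))%:E)%E.
Proof.
move=> eta0 eps0.
have e0 : 0 < (2 * eps) ^+ n by rewrite exprn_gt0// mulr_gt0.
have jm v : param_measurable (fun t w => (newton_indicator (val : A -> _) v eta ((1 + eta) * eps) w (fun ia => X ia t))%:E).
  move=> d' U h g mh mg; apply: measurable_newton_indicator => // p.
  exact: (measurableT_comp (measurable_funP (X p))).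
rewrite /newton_volume ge0_integral_sum//; last 2 first.
- move=> v; apply: measurable_funeM.
  apply: (param_measurable_iter_int leb (enum 'I_n) (jm v) _ (h := id) (g := fun=> fun=> 0%R)) => //.
  by move=> t w; rewrite lee_fin newton_indicator_ge0.
- move=> v t _; apply: mule_ge0; first by rewrite lee_fin invr_ge0 ltW.
  by apply: iter_int_ge0 => w; rewrite lee_fin newton_indicator_ge0.
set b := _ ^+ n * _ * _.
apply: (@le_trans _ _ (\sum_(v <- hull_vertices A) b%:E)%E); last first.
  by rewrite sumEFin lee_fin big_const_seq count_predT iter_addr addr0 mulr_natl.
apply: lee_sum => v _; rewrite ge0_integralZl_EFin//; last first.
- by rewrite invr_ge0 ltW.
- apply: (param_measurable_iter_int leb (enum 'I_n) (jm v) _ (h := id) (g := fun=> fun=> 0%R)) => //.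
  by move=> t w; rewrite lee_fin newton_indicator_ge0.
- by move=> t _; apply: iter_int_ge0 => w; rewrite lee_fin newton_indicator_ge0.
rewrite integral_iter_intC//; last by move=> t w; rewrite lee_fin newton_indicator_ge0.
have r0 : 0 <= (1 + eta) * eps by rewrite mulr_ge0 ?ltW// ltr_wpDr.
apply: (@le_trans _ _ (((2 * eps) ^+ n)^-1%:E *
    ((2 * ((1 + eta) * eps) * expR eta) ^+ n * (vol_proj R n)^-1 * 'C(#|` A|.-1, n)%:R)%:E)%E).
  apply: lee_wpmul2l; first by rewrite lee_fin invr_ge0 ltW.
  rewrite cardfE.
  exact: (integral_expectation_newton_indicator _
    (fun ia => c_gaussian.1 (tag ia) (tagged ia)) c_gaussian.2).
rewrite -EFinM lee_fin /b.
have -> : (2 * ((1 + eta) * eps) * expR eta) ^+ n = (2 * eps) ^+ n * ((1 + eta) * expR eta) ^+ n.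
  by rewrite -exprMn; congr (_ ^+ _); ring.
by rewrite -!mulrA mulKf// gt_eqF.
Qed.

(** Fatou's lemma, along eps = 1, 1/2, 1/3 and so on. *)
Lemma expected_zeros_le_eta eta : 0 < eta ->
  (expected_nondegenerate_zeros (A := fun=> A) c <=
   ((size (hull_vertices A))%:R * (((1 + eta) * expR eta) ^+ n * (vol_proj R n)^-1 *
     'C(#|` A|.-1, n)%:R))%:E)%E.
Proof.
move=> eta0; apply: (@le_trans _ _ (\int[P]_t limn_einf (fun k => volume eta (harmonic k) t))%E).
  apply: ge0_le_integralT => t.
    by rewrite /counting; case: asboolP => // _; rewrite lee_fin.
  exact: counting_le_newton_volume.
apply: le_trans (fatou _ _ _ _) _ => //.
- by move=> k; exact: measurable_newton_volume.
- by move=> k t _; apply: newton_volume_ge0; exact: harmonic_ge0.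
apply: limn_einf_le => k; apply: expectation_newton_volume; first exact: ltW.
exact: harmonic_gt0.
Qed.

(** The limit as eta tends to 0. *)
Lemma expected_zeros_le :
  (expected_nondegenerate_zeros (A := fun=> A) c <=
   ((vol_proj R n)^-1 * (size (hull_vertices A))%:R * 'C(#|` A|.-1, n)%:R)%:E)%E.
Proof.
pose B (eta : R) := (size (hull_vertices A))%:R * (((1 + eta) * expR eta) ^+ n * (vol_proj R n)^-1 *
     'C(#|` A|.-1, n)%:R).
have cB : B @ 0^'+ --> B 0.
  apply: cvg_at_right_filter; rewrite /B.
  apply: cvgMr; apply: cvgMl; apply: cvgMl.
  apply: (cvg_comp (fun s : R => (1 + s) * expR s) (fun s => s ^+ n)); last exact: exprn_continuous.
  apply: cvgM; first by apply: cvgD; [exact: cvg_cst|exact: cvg_id].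
  exact: continuous_expR.
have -> : (vol_proj R n)^-1 * (size (hull_vertices A))%:R * 'C(#|` A|.-1, n)%:R = B 0.
  by rewrite /B addr0 expR0 mulr1 expr1n mul1r mulrA (mulrC (vol_proj R n)^-1).
have cEB : (EFin \o B) x @[x --> 0^'+] --> (B 0)%:E by apply: cvg_EFin => //; exact: nearW.
apply: (cvge_ge _ cEB).
near=> eta; apply: expected_zeros_le_eta.
by near: eta; exact: nbhs_right_gt.
Unshelve. all: by end_near. Qed.

Lemma size_hull_vertices V0 :
  (vertices (convex_hull [set` A]) #= `I_V0)%card -> (size (hull_vertices A) <= V0)%N.
Proof.
move=> cardV.
have fV : finite_set (vertices (convex_hull [set` A])) by exists V0.
have <- : #|` fset_set (vertices (convex_hull [set` A]))|%fset = V0.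
  exact/card_fset_set.
rewrite -(size_map val); apply: uniq_leq_size.
  by rewrite map_inj_uniq ?enum_uniq//; exact: val_inj.
move=> _ /mapP[v + ->]; rewrite mem_enum => /asboolP vV.
by rewrite in_fset_set// inE.
Qed.

End expected_count.

Theorem proposition1p3 (R : realType) (n t V0 : nat) (A : {fset 'rV[R]_n})
  (n_ge1 : (1 <= n)%N) (t_ge1 : (1 <= t)%N) (cardA : #|` A|%fset = t)
  (cardV : (vertices (convex_hull [set` A]) #= `I_V0)%card)
  (d : measure_display) (T : measurableType d) (P : probability T R)
  (c : 'I_n -> A -> {RV P >-> R})
  (c_gaussian : iid_standard_gaussian (A := fun=> A) c) :
  (expected_nondegenerate_zeros (A := fun=> A) c <=
     ((vol_proj R n)^-1 * V0%:R * 'C(t.-1, n)%:R)%:E)%E.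
Proof.
rewrite -cardA in t_ge1 *.
apply: le_trans (expected_zeros_le t_ge1 c_gaussian) _.
have [v0 _] := cauchy_intE (R := R) n.
rewrite lee_fin; apply: ler_wpM2r => //.
apply: ler_wpM2l; first by rewrite invr_ge0 ltW.
by rewrite ler_nat size_hull_vertices.
Qed.
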